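(* Let $a\in(0,\frac12)$, $\alpha=(2(1-2a))^{1/2}$, $\beta=(8a(1-2a))^{1/2}$, and let $$A(t,x)=e^{it}\left[1+\frac{\alpha^2\cosh(\beta t)+i\beta\sinh(\beta t)}{\sqrt{2a}\,\cos(\alpha x)-\cosh(\beta t)}\right],\qquad t,x\in\mathbb{R},$$ be the Akhmediev breather, a smooth solution, $\frac{2\pi}{\alpha}$-periodic in $x$, of the focusing cubic nonlinear Schrödinger equation $i\partial_t u+\partial_x^2u+|u|^2u=0$. Then for every $s>\frac12$ (and every reference time $t_0\in\mathbb{R}$) $A$ is unstable under small perturbations in $H^s_\sharp$; that is, $A$ is not orbitally stable in $H^s_\sharp$.
   Context: NLS denotes the equation $i\partial_t u+\partial_x^2u+|u|^2u=0$, $u=u(t,x)\in\mathbb{C}$, $t,x\in\mathbb{R}$. $H^s_\sharp=H^s_\sharp((0,\frac{2\pi}{\alpha}))$ is the standard Sobolev space $H^s$ of complex-valued $\frac{2\pi}{\alpha}$-periodic functions of $x$. Orbital stability. Fix $s>\frac12$ and $t_0\in\mathbb{R}$. A globally defined solution $U=e^{it}(1+W)$ of NLS that is $\frac{2\pi}{\alpha}$-periodic in $x$ is called orbitally stable in $H^s_\sharp$ if there are constants $C_0,\varepsilon_0>0$ such that, for any $0<\varepsilon<\varepsilon_0$ and any $u_0$ with $\|u_0-U(t_0)\|_{H^s_\sharp}<\varepsilon$, the solution $u(t)$ of NLS with initial datum $u(t_0)=u_0$ is defined for all $t\in\mathbb{R}$ and there exist functions $x_0(t),\gamma_0(t)\in\mathbb{R}$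 such that $$\sup_{t\in\mathbb{R}}\|u(t)-e^{i\gamma_0(t)}U(t,\cdot-x_0(t))\|_{H^s_\sharp}<C_0\,\varepsilon.$$ If this condition is not satisfied, $U$ is called unstable. Here solutions of NLS with data $u_0\in H^s_\sharp$ at time $t_0$ are the $H^s_\sharp$-valued, continuous-in-time (mild/Duhamel) solutions given by local well-posedness of NLS in $H^s_\sharp$ for $s>\frac12$. *)

(* Defs.v *)
From HB Require Import structures.
From mathcomp Require Import all_boot all_order all_algebra.
From mathcomp Require Import all_classical all_reals all_analysis.
From mathcomp Require Import complex.
Set Implicit Arguments.
Unset Strict Implicit.
Unset Printing Implicit Defensive.
Import Order.TTheory GRing.Theory Num.Theory numFieldNormedType.Exports.
Import ComplexField.Normc.

Local Open Scope classical_set_scope.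
Local Open Scope ring_scope.
Local Open Scope complex_scope.

Definition cexpi (R : realType) (x : R) : R[i] := cos x +i* sin x.

Definition cosh (R : realType) (x : R) : R := (expR x + expR (- x)) / 2.
Definition sinh (R : realType) (x : R) : R := (expR x - expR (- x)) / 2.

(* Lebesgue integral of a complex-valued function, componentwise; only used on
   integrable functions, since [Rintegral] is total. *)
Definition Cintegral (R : realType) (D : set R) (f : R -> R[i]) : R[i] :=
  (\int[lebesgue_measure]_(x in D) complex.Re (f x)) +i*
  (\int[lebesgue_measure]_(x in D) complex.Im (f x)).

(* The oriented integral from [x] to [y]. *)
Definition Cintegral_from_to (R : realType) (x y : R) (f : R -> R[i]) : R[i] :=
  if x <= y then Cintegral `[x, y] f else - Cintegral `[y, x] f.

Section PeriodicSobolev.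
(* The period is [2 pi / alpha], so the k-th Fourier mode is
   [x |-> exp (i alpha k x)], of frequency [alpha k]. *)
Variables (R : realType) (alpha : R).
Implicit Types (f g : R -> R[i]) (s t : R) (k : int).

Definition period : R := 2 * pi / alpha.

Definition freq k : R := alpha * k%:~R.

Definition fourier_coef f k : R[i] :=
  (period^-1)%:C * Cintegral `[0, period] (fun x => f x * cexpi (- (freq k * x))).

Definition Hs_norm s f : \bar R :=
  ((\esum_(k in [set: int])
     ((1 + freq k ^+ 2) `^ s * normc (fourier_coef f k) ^+ 2)%:E) `^ (2^-1))%E.

Definition Hs_dist s f g : \bar R := Hs_norm s (fun x => f x - g x).

(* Functions rather than classes: two members of [Hs s] agree almost everywhere
   iff their [Hs_dist s] is 0.  For [s >= 0], H^s is a subspace of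
   L^2 of the circle. *)
Definition Hs s f : Prop :=
  [/\ forall x, f (x + period) = f x,
      measurable_fun setT (fun x => complex.Re (f x)),
      measurable_fun setT (fun x => complex.Im (f x)),
      (\int[lebesgue_measure]_(x in `[0%R, period]) (normc (f x) ^+ 2)%:E < +oo)%E
    & (Hs_norm s f < +oo)%E].

(* [exp (i t d^2/dx^2)] is the Fourier multiplier with symbol
   [exp (- i t (alpha k)^2)]. *)
Definition free_symbol t k : R[i] := cexpi (- (t * freq k ^+ 2)).

Definition cubic f : R -> R[i] := fun x => `|f x| ^+ 2 * f x.

(* Duhamel's formula
     u(t) = e^{i(t-t0)d_x^2} u0
              + i \int_{t0}^t e^{i(t-t')d_x^2} (|u|^2 u)(t') dt'
   as an identity in H^s: an element of H^s is determined by its Fourier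
   coefficients, and each of these is a continuous linear functional, hence
   commutes with the time integral of the continuous H^s-valued integrand. *)
Definition duhamel t0 (u0 : R -> R[i]) (u : R -> R -> R[i]) : Prop :=
  forall t k,
    fourier_coef (u t) k =
      free_symbol (t - t0) k * fourier_coef u0 k
      + 'i%C * Cintegral_from_to t0 t
               (fun t' => free_symbol (t - t') k * fourier_coef (cubic (u t')) k).

(* A solution of [i u_t + u_xx + |u|^2 u = 0], [u(t0) = u0], in C(R; H^s). *)
Definition global_solution s t0 (u0 : R -> R[i]) (u : R -> R -> R[i]) : Prop :=
  [/\ u t0 = u0,
      forall t, Hs s (u t),
      forall t, Hs_dist s (u t') (u t) @[t' --> t] --> 0%E
    & duhamel t0 u0 u].

(* Solutions in C(R; H^s), s > 1/2, are unique, so "the solution with datum u0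
   is defined for all t" is the existence of [u] below. *)
Definition orbitally_stable s t0 (U : R -> R -> R[i]) : Prop :=
  exists C0 eps0 : R,
    [/\ 0 < C0, 0 < eps0 &
      forall eps, 0 < eps -> eps < eps0 ->
      forall u0, Hs s u0 -> (Hs_dist s u0 (U t0) < eps%:E)%E ->
      exists2 u, global_solution s t0 u0 u &
      exists x0 gamma0 : R -> R,
        (ereal_sup [set Hs_dist s (u t)
             (fun x => cexpi (gamma0 t) * U t (x - x0 t))%R | t in [set: R]]
         < (C0 * eps)%:E)%E].

End PeriodicSobolev.

Definition akhmediev_alpha (R : realType) (a : R) : R :=
  Num.sqrt (2 * (1 - 2 * a)).

Definition akhmediev_beta (R : realType) (a : R) : R :=
  Num.sqrt (8 * a * (1 - 2 * a)).

Definition akhmediev (R : realType) (a t x : R) : R[i] :=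
  let alpha := akhmediev_alpha a in
  let beta := akhmediev_beta a in
  cexpi t *
  (1 + ((alpha ^+ 2 * cosh (beta * t)) +i* (beta * sinh (beta * t)))
       / (Num.sqrt (2 * a) * cos (alpha * x) - cosh (beta * t))%:C).

(* Main.v *)
Require Import Defs.
From HB Require Import structures.
From mathcomp Require Import all_boot all_order all_algebra.
From mathcomp Require Import all_classical all_reals all_analysis.
From mathcomp Require Import measurable_realfun complex.
From mathcomp Require Import ring lra zify.
Import Order.TTheory GRing.Theory Num.Theory.
Import numFieldNormedType.Exports ComplexField.Normc.

(* The momentum P(u) = sum_k (alpha k) |u_k|^2 is conserved by every solution in
   C(R; H^s), s > 1/2, and it is quadratic near the constants because only the
   modes k <> 0 contribute. The breather A(t) converges, as t -> +oo, to the orbit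
   of a constant; so if A were orbitally stable, a solution starting eps-close to
   A(t0) would be O(eps)-close to a constant at a large time T, and its momentum
   would be O(eps^2). But P(A) = 0, and A(t0) is not a critical point of P:
   perturbing its first Fourier mode by a multiple of itself of size eps gives
   data of momentum at least q * eps with q > 0, a contradiction for small eps.

   For rough solutions the time derivative of the truncated momentum is a quartic
   sum over resonant frequencies a + c = b + d. On a symmetric box this sum
   vanishes by symmetry; the error made by cutting frequencies off is dominated by
   the tail of an absolutely convergent series, and tends to 0 boundedly in time. *)

Set Implicit Arguments.
Unset Strict Implicit.
Unset Printing Implicit Defensive.
Local Open Scope classical_set_scope.
Local Open Scope ring_scope.
Local Open Scope complex_scope.

(** * Frequency boxes and complex numbers *)

(** For [s] close to 1/2 a solution in C(R; H^s) has too few derivatives to integrate by parts in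
    the momentum, so everything is expressed through Fourier coefficients. The condition s > 1/2
    makes [|alpha k| <= (1 + (alpha k)^2)^s], so that the momentum is controlled by the H^s energy,
    and it makes the inverse weights summable, so that the coefficients are absolutely summable and
    the cubic term is an absolutely convergent convolution.

    A member of [Hs] is only a measurable representative, while the cubic term acts pointwise;
    passing to the Fourier series needs completeness of the trigonometric system, obtained here from
    polynomials in one cosine.

    In [x] the breather is an affine function of a Poisson kernel. Its coefficients are therefore
    geometric in [|k|]; they are even in [k], which gives zero momentum, and those with [k <> 0]
    carry a factor [1 / cosh (beta t)], which gives convergence to the orbit of a constant. *)

(* Locked, since unification would otherwise expand a box into an explicit list. *)
Definition box (M : nat) : seq int :=
  locked [seq i%:Z - M%:Z | i <- iota 0 M.*2.+1].

Lemma mem_box M k : (k \in box M) = (`|k| <= M)%N.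
Proof.
rewrite /box -lock; apply/mapP/idP => [[j]|kM]; first by rewrite mem_iota => jM ->; lia.
exists (absz (k + M%:Z)); last by lia.
by rewrite mem_iota; lia.
Qed.

Lemma box_uniq M : uniq (box M).
Proof. by rewrite /box -lock map_inj_uniq ?iota_uniq// => i j; lia. Qed.

Lemma big_box0 (V : nmodType) (F : int -> V) : \sum_(k <- box 0) F k = F 0.
Proof. by rewrite /box -lock /= big_seq1. Qed.

Lemma big_boxS (V : nmodType) (F : int -> V) M :
  \sum_(k <- box M.+1) F k =
  F M.+1%:Z + F (- M.+1%:Z) + \sum_(k <- box M) F k.
Proof.
have /(perm_big _) -> : perm_eq (box M.+1) (M.+1%:Z :: - M.+1%:Z :: box M).
  apply: uniq_perm; first exact: box_uniq.
    by rewrite 2!cons_uniq box_uniq in_cons !mem_box; lia.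
  by move=> k; rewrite 2!in_cons !mem_box; lia.
by rewrite /= 2!big_cons addrA.
Qed.

Lemma big_box_mask (V : nmodType) (F : int -> V) M L : (M <= L)%N ->
  \sum_(k <- box L | k \in box M) F k = \sum_(k <- box M) F k.
Proof.
move=> ML; rewrite -big_filter; apply: perm_big; apply: uniq_perm.
- by rewrite filter_uniq// box_uniq.
- exact: box_uniq.
- by move=> k; rewrite mem_filter !mem_box; lia.
Qed.

Lemma big_box_pred1 (V : nmodType) (F : int -> V) j L : (`|j| <= L)%N ->
  \sum_(k <- box L | k == j) F k = F j.
Proof.
move=> jL; rewrite -big_filter (_ : [seq k <- box L | k == j] = [:: j]) ?big_seq1//.
by rewrite filter_pred1_uniq ?box_uniq// mem_box.
Qed.

Section RealBox.
Context {R : realType}.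
Implicit Types (F G : int -> R).

Lemma le_sum_box F M L : (forall k, 0 <= F k) -> (M <= L)%N ->
  \sum_(k <- box M) F k <= \sum_(k <- box L) F k.
Proof.
move=> F0 ML; rewrite -(big_box_mask _ ML) [leRHS](bigID [in box M])/=.
by rewrite lerDl sumr_ge0.
Qed.

(* At most one index of the box is selected, whence the bound. *)
Lemma sum_box_pred1_le (x : R) j L : 0 <= x ->
  \sum_(k <- box L | k == j) x <= x.
Proof.
move=> x0; have [jL|jL] := leqP `|j| L; first by rewrite (big_box_pred1 (fun=> x)).
by rewrite big_seq_cond big1// => k; rewrite mem_box; lia.
Qed.

End RealBox.

Section Complex.
Context {R : realType}.
Implicit Types (z w : R[i]) (x y : R).

Lemma cReD z w : complex.Re (z + w) = complex.Re z + complex.Re w.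
Proof. by case: z w => a b [c d]. Qed.
Lemma cImD z w : complex.Im (z + w) = complex.Im z + complex.Im w.
Proof. by case: z w => a b [c d]. Qed.
Lemma cReB z w : complex.Re (z - w) = complex.Re z - complex.Re w.
Proof. by case: z w => a b [c d]. Qed.
Lemma cImB z w : complex.Im (z - w) = complex.Im z - complex.Im w.
Proof. by case: z w => a b [c d]. Qed.
Lemma cReM z w : complex.Re (z * w) =
  complex.Re z * complex.Re w - complex.Im z * complex.Im w.
Proof. by case: z w => a b [c d]. Qed.
Lemma cImM z w : complex.Im (z * w) =
  complex.Re z * complex.Im w + complex.Im z * complex.Re w.
Proof. by case: z w => a b [c d]. Qed.
Lemma Re_conjc z : complex.Re (conjc z) = complex.Re z.
Proof. by case: z. Qed.
Lemma Im_conjc z : complex.Im (conjc z) = - complex.Im z.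
Proof. by case: z. Qed.

Lemma conjcM z w : conjc (z * w) = conjc z * conjc w.
Proof. exact: (rmorphM (@conjc R)). Qed.

Lemma conjc_sum I (r : seq I) (P : pred I) (F : I -> R[i]) :
  conjc (\sum_(i <- r | P i) F i) = \sum_(i <- r | P i) conjc (F i).
Proof. exact: (rmorph_sum (@conjc R)). Qed.

Lemma cRe_sum I (r : seq I) (P : pred I) (F : I -> R[i]) :
  complex.Re (\sum_(i <- r | P i) F i) = \sum_(i <- r | P i) complex.Re (F i).
Proof. exact: (big_morph _ cReD). Qed.
Lemma cIm_sum I (r : seq I) (P : pred I) (F : I -> R[i]) :
  complex.Im (\sum_(i <- r | P i) F i) = \sum_(i <- r | P i) complex.Im (F i).
Proof. exact: (big_morph _ cImD). Qed.

Lemma normc_ge0 z : 0 <= normc z.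
Proof. by case: z => a b; rewrite sqrtr_ge0. Qed.

Lemma normcC x : normc x%:C = `|x|.
Proof. by rewrite /= expr0n addr0 sqrtr_sqr. Qed.

Lemma sqr_normcE z : normc z ^+ 2 = complex.Re z ^+ 2 + complex.Im z ^+ 2.
Proof. by case: z => a b /=; rewrite sqr_sqrtr// addr_ge0// sqr_ge0. Qed.

Lemma normc_conj z : normc (conjc z) = normc z.
Proof. by case: z => a b /=; rewrite sqrrN. Qed.

Lemma normRe_le z : `|complex.Re z| <= normc z.
Proof.
by case: z => a b /=; rewrite -sqrtr_sqr ler_wsqrtr// lerDl sqr_ge0.
Qed.
Lemma normIm_le z : `|complex.Im z| <= normc z.
Proof.
by case: z => a b /=; rewrite -sqrtr_sqr ler_wsqrtr// lerDr sqr_ge0.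
Qed.

Lemma normc_le z : normc z <= `|complex.Re z| + `|complex.Im z|.
Proof.
rewrite -(ler_pXn2r (n := 2)) ?nnegrE ?normc_ge0 ?addr_ge0//.
rewrite sqr_normcE sqrrD !real_normK ?num_real//.
by rewrite addrAC lerDl mulrn_wge0 ?mulr_ge0.
Qed.

Lemma le_normcB z w : normc (z - w) <= normc z + normc w.
Proof. by rewrite -(normcN w); apply: le_normcD. Qed.

Lemma normc_sum I (r : seq I) (P : pred I) (F : I -> R[i]) :
  normc (\sum_(i <- r | P i) F i) <= \sum_(i <- r | P i) normc (F i).
Proof.
elim/big_rec2: _ => [|i x y _ yx]; first by rewrite normc0.
by rewrite (le_trans (le_normcD _ _))// lerD2l.
Qed.

Lemma cubicE (f : R -> R[i]) x : cubic f x = f x * conjc (f x) * f x.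
Proof. by rewrite /cubic sqr_normc. Qed.

Lemma conj_mul_self z : z * conjc z = (normc z ^+ 2)%:C.
Proof.
rewrite sqr_normcE; case: z => a b; apply/eqP; rewrite eq_complex /=.
by apply/andP; split; apply/eqP; ring.
Qed.

(** Replacing [z] by [w] one factor at a time leaves three terms, each a difference times two
    factors bounded by [X]. *)
Lemma normc_cube_le z w (X : R) : normc z <= X -> normc w <= X ->
  normc (z * conjc z * z - w * conjc w * w) <= 3 * X ^+ 2 * normc (z - w).
Proof.
move=> zX wX; have X0 : 0 <= X := le_trans (normc_ge0 z) zX.
have -> : z * conjc z * z - w * conjc w * w =
  (z - w) * (conjc z * z) + w * (conjc (z - w) * z) + w * conjc w * (z - w).
  by rewrite rmorphB; ring.
apply: le_trans (le_normcD _ _) _; apply: le_trans (lerD (le_normcD _ _) (lexx _)) _.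
rewrite !normcM !normc_conj.
set d := normc (z - w); have d0 : 0 <= d := normc_ge0 _.
have [z0 w0] := (normc_ge0 z, normc_ge0 w).
have h1 : normc z * normc z <= X ^+ 2 by rewrite expr2 ler_pM.
have h2 : normc w * normc z <= X ^+ 2 by rewrite expr2 ler_pM.
have h3 : normc w * normc w <= X ^+ 2 by rewrite expr2 ler_pM.
by nra.
Qed.

Lemma cexpi0 : cexpi 0 = 1 :> R[i].
Proof. by rewrite /cexpi cos0 sin0. Qed.

Lemma cexpiD x y : cexpi (x + y) = cexpi x * cexpi y.
Proof.
apply/eqP; rewrite eq_complex /= cosD sinD eqxx /=.
by apply/eqP; ring.
Qed.

Lemma conj_cexpi x : conjc (cexpi x) = cexpi (- x).
Proof. by rewrite /cexpi cosN sinN. Qed.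

Lemma normc_cexpi x : normc (cexpi x) = 1.
Proof. by rewrite /= cos2Dsin2 sqrtr1. Qed.

Lemma cexpi_period_int x (k : int) : cexpi (x + 2 * pi * k%:~R) = cexpi x.
Proof.
have hn y (n : nat) : cexpi (y + 2 * pi * n%:R) = cexpi y.
  have -> : 2 * pi * n%:R = (pi *+ 2) *+ n :> R by rewrite -mulr_natr; ring.
  by rewrite /cexpi (periodicn (@cosD2pi R)) (periodicn (@sinD2pi R)).
case: k => n; first by rewrite -pmulrn hn.
rewrite -(hn (x + _) n.+1); congr cexpi.
by rewrite NegzE mulrNz -pmulrn; ring.
Qed.

End Complex.

(** * Resonant quadruples of frequencies *)

Section Quadruples.
Context {R : realType}.
Implicit Types (s : seq int) (h : int -> int -> int -> int -> R) (f g m : int -> R).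

Definition quad s h : R :=
  \sum_(a <- s) \sum_(b <- s) \sum_(c <- s) \sum_(d <- s) h a b c d.

Lemma quad_swap12 s h : quad s h = quad s (fun a b c d => h b a c d).
Proof. exact: exchange_big. Qed.

(** The three adjacent transpositions generate all permutations of the four summation indices. *)
Lemma quad_swap23 s h : quad s h = quad s (fun a b c d => h a c b d).
Proof. by apply: eq_bigr => a _; exact: exchange_big. Qed.

Lemma quad_swap34 s h : quad s h = quad s (fun a b c d => h a b d c).
Proof. by do 2 apply: eq_bigr => ? _; exact: exchange_big. Qed.

Lemma eq_quad s h h' : (forall a b c d, h a b c d = h' a b c d) ->
  quad s h = quad s h'.
Proof. by move=> hh'; do 4 apply: eq_bigr => ? _. Qed.

Lemma le_quad s h h' : (forall a b c d, h a b c d <= h' a b c d) ->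
  quad s h <= quad s h'.
Proof. by move=> hh'; do 4 apply: ler_sum => ? _. Qed.

Lemma quadD s h h' :
  quad s (fun a b c d => h a b c d + h' a b c d) = quad s h + quad s h'.
Proof.
by rewrite -big_split; apply: eq_bigr => a _; rewrite -big_split;
   apply: eq_bigr => b _; rewrite -big_split; apply: eq_bigr => c _;
   rewrite -big_split.
Qed.

Lemma quadZ s (x : R) h : quad s (fun a b c d => x * h a b c d) = x * quad s h.
Proof. by rewrite /quad; do 4 (rewrite mulr_sumr; apply: eq_bigr => ? _). Qed.

Lemma quadB s h h' :
  quad s (fun a b c d => h a b c d - h' a b c d) = quad s h - quad s h'.
Proof.
under eq_quad => a b c d do rewrite -mulN1r.
by rewrite quadD quadZ mulN1r.
Qed.

Lemma ler_norm_quad s h : `|quad s h| <= quad s (fun a b c d => `|h a b c d|).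
Proof.
by do 4 (apply: (le_trans (ler_norm_sum _ _ _)); apply: ler_sum => ? _).
Qed.

(** Encodes [a - b + c = d], the condition under which [u a * conjc (u b) * u c] feeds the mode [d];
    written as a real 0 or 1 so that it multiplies into the sums. *)
Definition resonant (a b c d : int) : R := (a + c == b + d)%:R.

Lemma resonant_ge0 a b c d : 0 <= resonant a b c d.
Proof. by rewrite ler0n. Qed.

Section Young.
Variables (L : nat) (f g m : int -> R).
Hypotheses (f0 : forall k, 0 <= f k) (g0 : forall k, 0 <= g k)
  (m0 : forall k, 0 <= m k).
Let s := box L.

(* Three of the indices determine the fourth one. *)
Let young (r : int -> int -> int -> int -> bool) (j : int -> int -> int -> int) :
  (forall a b c d, r a b c d -> d = j a b c) ->
  quad s (fun a b c d => (r a b c d)%:R * (f a * g b * m c)) <=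
  (\sum_(k <- s) f k) * (\sum_(k <- s) g k) * (\sum_(k <- s) m k).
Proof.
move=> rj; rewrite -mulrA mulr_suml; apply: ler_sum => a _.
rewrite mulr_suml mulr_sumr; apply: ler_sum => b _.
rewrite mulrA mulr_sumr; apply: ler_sum => c _.
have p0 : 0 <= f a * g b * m c by rewrite !mulr_ge0.
apply: le_trans (sum_box_pred1_le (j a b c) L p0).
rewrite [leRHS]big_mkcond; apply: ler_sum => d _.
case: ifPn => [_|djN]; first by rewrite ler_piMl ?lern1 ?leq_b1.
by case: (boolP (r a b c d)) djN => [/rj->|_ _]; rewrite ?eqxx ?mul0r.
Qed.

Let bound := (\sum_(k <- s) f k) * (\sum_(k <- s) g k) * (\sum_(k <- s) m k).

Lemma young_abc :
  quad s (fun a b c d => resonant a b c d * (f a * g b * m c)) <= bound.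
Proof. by apply: (@young _ (fun a b c => a + c - b)) => a b c d; lia. Qed.

Lemma young_abd :
  quad s (fun a b c d => resonant a b c d * (f a * g b * m d)) <= bound.
Proof.
rewrite quad_swap34.
by apply: (@young (fun a b c d => _ == _) (fun a b c => b + c - a)) => a b c d; lia.
Qed.

Lemma young_acd :
  quad s (fun a b c d => resonant a b c d * (f a * g c * m d)) <= bound.
Proof.
rewrite quad_swap23 quad_swap34.
by apply: (@young (fun a b c d => _ == _) (fun a b c => a + b - c)) => a b c d; lia.
Qed.

Lemma young_bcd :
  quad s (fun a b c d => resonant a b c d * (f b * g c * m d)) <= bound.
Proof.
rewrite quad_swap12 quad_swap23 quad_swap34.
by apply: (@young (fun a b c d => _ == _) (fun a b c => a + c - b)) => a b c d; lia.
Qed.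

End Young.

(** Squaring the right-hand side adds only nonnegative cross terms to [|y| + |z| + |t|]. The
    hypothesis has the shape in which resonance expresses an additive weight at one index by the
    three others. *)
Lemma sqrt_norm_add_le (x y z t : R) : x = y - z + t ->
  Num.sqrt `|x| <= Num.sqrt `|y| + Num.sqrt `|z| + Num.sqrt `|t|.
Proof.
move=> ->; rewrite -(ler_pXn2r (n := 2)) ?nnegrE ?addr_ge0 ?sqrtr_ge0//.
rewrite sqr_sqrtr//.
have hs (u : R) : Num.sqrt `|u| ^+ 2 = `|u| by rewrite sqr_sqrtr.
have := (hs y, hs z, hs t); have := (sqrtr_ge0 `|y|, sqrtr_ge0 `|z|, sqrtr_ge0 `|t|).
move: (Num.sqrt `|y|) (Num.sqrt `|z|) (Num.sqrt `|t|) => p q r [[p0 q0] r0] [[Hp Hq] Hr].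
have : `|y - z + t| <= `|y| + `|z| + `|t|.
  by rewrite (le_trans (ler_normD _ _))// lerD2r ler_normB.
by move=> /le_trans; apply; nra.
Qed.

(* With [v k] the square root of [`|w k|], resonance gives
   [v d <= v a + v b + v c]; AM-GM then leaves one squared factor
   [v ^+ 2 * m ^+ 2] and two factors [m]. *)
Lemma quad_weight_le L (w m : int -> R) (X Y : R) :
  (forall a b, w (a + b) = w a + w b) -> (forall k, 0 <= m k) ->
  \sum_(k <- box L) m k <= X -> \sum_(k <- box L) `|w k| * m k ^+ 2 <= Y ->
  quad (box L) (fun a b c d =>
    resonant a b c d * (`|w d| * (m a * m b * m c * m d))) <= 3 * (X ^+ 2 * Y).
Proof.
move=> wD m0 mX wmY; pose v (k : int) : R := Num.sqrt `|w k|.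
have vE k : v k ^+ 2 = `|w k| by rewrite sqr_sqrtr.
have v0 k : 0 <= v k by exact: sqrtr_ge0.
pose e (k : int) : R := `|w k| * m k ^+ 2.
have e0 k : 0 <= e k by rewrite mulr_ge0 ?sqr_ge0.
(* Each of the three uses of AM-GM yields two terms: [e] sits at [d] or at the index split off by
   [vabc], and [m] at two of the others. The index left out is recovered from resonance, so Young's
   bound applies to all six. *)
pose A1 := fun a b c d => resonant a b c d * (m b * m c * e d).
pose A2 := fun a b c d => resonant a b c d * (e a * m b * m c).
pose A3 := fun a b c d => resonant a b c d * (m a * m c * e d).
pose A4 := fun a b c d => resonant a b c d * (m a * e b * m c).
pose A5 := fun a b c d => resonant a b c d * (m a * m b * e d).
pose A6 := fun a b c d => resonant a b c d * (m a * m b * e c).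
have : quad (box L) (fun a b c d =>
    resonant a b c d * (`|w d| * (m a * m b * m c * m d))) <=
  quad (box L) (fun a b c d => 2^-1 * (A1 a b c d + A2 a b c d + A3 a b c d +
    A4 a b c d + A5 a b c d + A6 a b c d)).
  apply: le_quad => a b c d; rewrite /A1 /A2 /A3 /A4 /A5 /A6 /resonant.
  have [abcd|_] := eqVneq (a + c) (b + d); last by rewrite !mul0r !addr0 mulr0.
  rewrite !mul1r /e -!vE.
  have vabc : v d <= v a + v b + v c.
    apply: sqrt_norm_add_le.
    have : w a + w c = w b + w d by rewrite -!wD abcd.
    by lra.
  move: (m0 a) (m0 b) (m0 c) (m0 d) (v0 a) (v0 b) (v0 c) (v0 d) vabc => {vE v0 e0 e A1 A2 A3 A4 A5 A6}.
  move: (m a) (m b) (m c) (m d) (v a) (v b) (v c) (v d) => ma mb mc md va vb vc vd.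
  move=> ma0 mb0 mc0 md0 va0 vb0 vc0 vd0 vabc.
  have P0 : 0 <= vd * (ma * mb * mc * md) by rewrite !mulr_ge0.
  have h0 : vd ^+ 2 * (ma * mb * mc * md) <= (va + vb + vc) * (vd * (ma * mb * mc * md)).
    by rewrite expr2 -mulrA ler_wpM2r.
  apply: le_trans h0 _.
  have am (x y z : R) : 0 <= z -> x * y * z <= 2^-1 * (x ^+ 2 * z + y ^+ 2 * z).
    by move=> z0; have := mulr_ge0 z0 (sqr_ge0 (x - y)); lra.
  have h1 := am (va * ma) (vd * md) _ (mulr_ge0 mb0 mc0).
  have h2 := am (vb * mb) (vd * md) _ (mulr_ge0 ma0 mc0).
  have h3 := am (vc * mc) (vd * md) _ (mulr_ge0 ma0 mb0).
  by rewrite !exprMn in h1 h2 h3; lra.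
move=> /le_trans; apply; rewrite quadZ !quadD.
have SX : \sum_(k <- box L) m k <= X := mX.
have Sm0 : 0 <= \sum_(k <- box L) m k by rewrite sumr_ge0.
have Se0 : 0 <= \sum_(k <- box L) e k by rewrite sumr_ge0.
have X0 := le_trans Sm0 mX.
have B : (\sum_(k <- box L) m k) * (\sum_(k <- box L) m k) * (\sum_(k <- box L) e k)
    <= X ^+ 2 * Y by rewrite expr2 !ler_pM// mulr_ge0.
have h1 : quad (box L) A1 <= X ^+ 2 * Y.
  by apply: le_trans B; apply: (@young_bcd L m m e).
have h2 : quad (box L) A2 <= X ^+ 2 * Y.
  by apply: le_trans B; apply: le_trans (@young_abc L e m m _ _ _) _ => //; lra.
have h3 : quad (box L) A3 <= X ^+ 2 * Y.
  by apply: le_trans B; apply: (@young_acd L m m e).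
have h4 : quad (box L) A4 <= X ^+ 2 * Y.
  by apply: le_trans B; apply: le_trans (@young_abc L m e m _ _ _) _ => //; lra.
have h5 : quad (box L) A5 <= X ^+ 2 * Y.
  by apply: le_trans B; apply: (@young_abd L m m e).
have h6 : quad (box L) A6 <= X ^+ 2 * Y.
  by apply: le_trans B; apply: (@young_abc L m m e).
by lra.
Qed.

(* Momentum conservation in frequency space: exchanging [a] with [c] or [b] with
   [d] leaves the product unchanged, exchanging both pairs conjugates it; so
   four times the sum carries the weight [w b + w d - w a - w c], which vanishes
   on resonant quadruples. *)
Lemma quad_momentum s (w : int -> R) (u : int -> R[i]) :
  (forall a b, w (a + b) = w a + w b) ->
  quad s (fun a b c d => resonant a b c d *
    (w d * complex.Im (u a * conjc (u b) * u c * conjc (u d)))) = 0.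
Proof.
move=> wD; pose z a b c d := complex.Im (u a * conjc (u b) * u c * conjc (u d)).
pose S := quad s (fun a b c d => resonant a b c d * (w d * z a b c d)).
pose Q w' := quad s (fun a b c d => resonant a b c d * (w' a b c d * z a b c d)).
have Sb : S = Q (fun a b c d => w b).
  rewrite /S quad_swap34 quad_swap23 quad_swap34.
  apply: eq_quad => a b c d; rewrite /resonant (addrC d b); congr (_ * (_ * _)).
  by rewrite /z; congr complex.Im; ring.
have zconj a b c d : z b a d c = - z a b c d.
  rewrite /z -Im_conjc; congr complex.Im.
  by rewrite !rmorphM /= !conjcK; ring.
have Sc : S = - Q (fun a b c d => w c).
  rewrite /S quad_swap12 quad_swap34 -mulN1r -quadZ.
  by apply: eq_quad => a b c d; rewrite /resonant eq_sym zconj; ring.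
have Sa : S = - Q (fun a b c d => w a).
  rewrite Sb /Q quad_swap12 quad_swap34 -mulN1r -quadZ.
  by apply: eq_quad => a b c d; rewrite /resonant eq_sym zconj; ring.
have : Q (fun a b c d => w a) + Q (fun a b c d => w c) =
       Q (fun a b c d => w b) + S.
  rewrite -!quadD; apply: eq_quad => a b c d; rewrite /resonant.
  have [abcd|_] := eqVneq (a + c) (b + d); last by rewrite !mul0r.
  by rewrite !mul1r -!mulrDl -!wD abcd.
by rewrite -/S; lra.
Qed.

End Quadruples.

(** * Truncated cubic convolution and its momentum flux *)

Section CubicConvolution.
Context {R : realType}.
Implicit Types (u : int -> R[i]) (w : int -> R).

Definition cubic_conv u L (d : int) : R[i] :=
  \sum_(a <- box L) \sum_(b <- box L) \sum_(c <- box L | a + c == b + d)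
    u a * conjc (u b) * u c.

Lemma quad_box_mask M L (h : int -> int -> int -> int -> R) : (M <= L)%N ->
  quad (box M) h = quad (box L) (fun a b c d =>
    [&& a \in box M, b \in box M, c \in box M & d \in box M]%:R * h a b c d).
Proof.
move=> ML; rewrite /quad -(big_box_mask _ ML) big_mkcond; apply: eq_bigr => a _.
case: ifP => aM; last first.
  by rewrite big1// => b _; rewrite big1// => c _; rewrite big1// => d _; rewrite mul0r.
rewrite -(big_box_mask _ ML) big_mkcond; apply: eq_bigr => b _.
case: ifP => bM; last by rewrite big1// => c _; rewrite big1// => d _; rewrite mul0r.
rewrite -(big_box_mask _ ML) big_mkcond; apply: eq_bigr => c _.
case: ifP => cM; last by rewrite big1// => d _; rewrite mul0r.
rewrite -(big_box_mask _ ML) big_mkcond; apply: eq_bigr => d _.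
by case: ifP => dM; rewrite ?mul1r ?mul0r.
Qed.

(** Absolute majorant of the sum in [quad_momentum]. It is nondecreasing in [L], so its increments
    measure what a frequency cutoff loses. *)
Definition flux_bound u w L := quad (box L) (fun a b c d => resonant a b c d *
  (`|w d| * (normc (u a) * normc (u b) * normc (u c) * normc (u d)))).

(** Only [d] is confined to [box M] on the left. Confining all four indices gives a sum that
    vanishes by [quad_momentum]; what remains lives on quadruples of [box L] with some index outside
    [box M], and their absolute values add up to at most the increment of [flux_bound]. *)
Lemma truncated_flux_le u w M L : (M <= L)%N ->
  (forall a b, w (a + b) = w a + w b) ->
  `|\sum_(d <- box M) w d * complex.Im (cubic_conv u L d * conjc (u d))| <=
  flux_bound u w L - flux_bound u w M.
Proof.
move=> ML wD.
pose h a b c d := resonant a b c d * (w d * complex.Im (u a * conjc (u b) * u c * conjc (u d))).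
pose h' a b c d := resonant a b c d *
  (`|w d| * (normc (u a) * normc (u b) * normc (u c) * normc (u d))).
have hh' a b c d : `|h a b c d| <= h' a b c d.
  rewrite /h /h' !normrM (ger0_norm (resonant_ge0 _ _ _ _)).
  rewrite ler_wpM2l ?resonant_ge0// ler_wpM2l//.
  by apply: le_trans (normIm_le _) _; rewrite !normcM !normc_conj.
have -> : \sum_(d <- box M) w d * complex.Im (cubic_conv u L d * conjc (u d)) =
    quad (box L) (fun a b c d => (d \in box M)%:R * h a b c d).
  rewrite /quad -(big_box_mask _ ML) big_mkcond.
  under [RHS]eq_bigr => a _.
    under eq_bigr => b _ do rewrite exchange_big.
    rewrite exchange_big; over.
  rewrite [RHS]exchange_big; apply: eq_bigr => d _.
  case: ifP => dM; last first.
    by rewrite big1// => a _; rewrite big1// => b _; rewrite big1// => c _; rewrite mul0r.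
  rewrite mulr_suml cIm_sum mulr_sumr; apply: eq_bigr => a _.
  rewrite mulr_suml cIm_sum mulr_sumr; apply: eq_bigr => b _.
  rewrite mulr_suml cIm_sum mulr_sumr big_mkcond; apply: eq_bigr => c _.
  by rewrite /h /resonant; case: ifP => _; rewrite ?mul1r ?mul0r.
have h0 : quad (box M) h = 0 by exact: quad_momentum.
rewrite -[X in `|X|]subr0 -h0 (quad_box_mask _ ML) /flux_bound (quad_box_mask _ ML) -!quadB.
apply: le_trans (ler_norm_quad _ _) _; apply: le_quad => a b c d.
rewrite -/(h' a b c d) -mulrBl normrM -[X in _ <= X - _]mul1r -mulrBl.
apply: ler_pM => //.
case: (d \in box M); rewrite ?andbT ?andbF; last by rewrite subr0 normr0 subr0.
by case: (a \in box M); case: (b \in box M); case: (c \in box M);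
  rewrite /= ?subrr ?subr0 ?normr0 ?normr1.
Qed.

Lemma flux_bound_homo u w M L : (M <= L)%N -> flux_bound u w M <= flux_bound u w L.
Proof.
move=> ML; rewrite /flux_bound (quad_box_mask _ ML); apply: le_quad => a b c d.
by rewrite ler_piMl ?lern1 ?leq_b1// mulr_ge0 ?resonant_ge0// !mulr_ge0// normc_ge0.
Qed.

Lemma flux_bound_ge0 u w L : 0 <= flux_bound u w L.
Proof.
by do 4 apply: sumr_ge0 => ? _; rewrite mulr_ge0 ?resonant_ge0// !mulr_ge0// normc_ge0.
Qed.

End CubicConvolution.

(** * Integrals and Fourier coefficients *)

Section RealIntegrals.
Context {R : realType}.
Notation mu := (@lebesgue_measure R).
Implicit Types (f g F : R -> R) (a b M : R).

Lemma seg_fin a b : (mu `[a, b]%classic < +oo)%E.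
Proof. by rewrite lebesgue_measure_itv/=; case: ifP => _; rewrite ?ltry// -EFinB ltry. Qed.

Lemma seg_length a b : a <= b -> fine (mu `[a, b]%classic) = b - a.
Proof.
rewrite lebesgue_measure_itv/= lte_fin le_eqVlt => /predU1P[->|->//].
by rewrite ltxx subrr.
Qed.

Lemma bounded_integrable a b f M : measurable_fun setT f ->
  (forall x, `|f x| <= M) -> mu.-integrable `[a, b] (EFin \o f).
Proof.
move=> mf fM; apply: measurable_bounded_integrable => //; first exact: seg_fin.
  exact: measurable_funS mf.
exists M; split; first exact: num_real.
by move=> y My x _ /=; rewrite (le_trans (fM x))// ltW.
Qed.

Lemma continuous_integrable a b f : continuous f ->
  mu.-integrable `[a, b] (EFin \o f).
Proof.
move=> cf; apply: continuous_compact_integrable; first exact: segment_compact.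
exact: continuous_subspaceT.
Qed.

Lemma integrable_mul_bounded a b f g M :
  mu.-integrable `[a, b] (EFin \o f) -> measurable_fun setT g ->
  (forall x, `|g x| <= M) -> mu.-integrable `[a, b] (EFin \o (fun x => f x * g x)).
Proof.
move=> fi mg gM.
have := @integrableMl _ _ _ mu `[a, b]%classic (measurable_itv _) (EFin \o f) g fi.
apply; first exact: measurable_funS mg.
exists M; split; first exact: num_real.
by move=> y My x _ /=; rewrite (le_trans (gM x))// ltW.
Qed.

Lemma integrable_segD a b f g : mu.-integrable `[a, b] (EFin \o f) ->
  mu.-integrable `[a, b] (EFin \o g) ->
  mu.-integrable `[a, b] (EFin \o (fun x => f x + g x)).
Proof.
move=> fi gi; have -> : EFin \o (fun x => f x + g x) = ((EFin \o f) \+ (EFin \o g))%E.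
  by apply/funext.
exact: integrableD.
Qed.

Lemma integrable_segZ a b r f : mu.-integrable `[a, b] (EFin \o f) ->
  mu.-integrable `[a, b] (EFin \o (fun x => r * f x)).
Proof.
move=> fi; have -> : EFin \o (fun x => r * f x) = (fun x => r%:E * (EFin \o f) x)%E.
  by apply/funext.
exact: integrableZl.
Qed.

Lemma integrable_segB a b f g : mu.-integrable `[a, b] (EFin \o f) ->
  mu.-integrable `[a, b] (EFin \o g) ->
  mu.-integrable `[a, b] (EFin \o (fun x => f x - g x)).
Proof.
move=> fi gi; have := integrable_segD fi (integrable_segZ (-1) gi).
by apply: eq_integrable => // x _; rewrite /= mulN1r.
Qed.

Lemma integrable_seg_sum a b I (r : seq I) (F : I -> R -> R) :
  (forall i, mu.-integrable `[a, b] (EFin \o F i)) ->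
  mu.-integrable `[a, b] (EFin \o (fun x => \sum_(i <- r) F i x)).
Proof.
move=> Fi; have -> : EFin \o (fun x => \sum_(i <- r) F i x) =
    (fun x => \sum_(i <- r) (EFin \o F i) x)%E.
  by apply/funext => x; rewrite /= sumEFin.
exact: integrable_sum.
Qed.

Lemma Rintegral_seg_sum a b I (r : seq I) (F : I -> R -> R) :
  (forall i, mu.-integrable `[a, b] (EFin \o F i)) ->
  \int[mu]_(x in `[a, b]) (\sum_(i <- r) F i x) =
  \sum_(i <- r) \int[mu]_(x in `[a, b]) F i x.
Proof.
move=> Fi; elim: r => [|i r ih].
  under eq_Rintegral do rewrite big_nil.
  by rewrite Rintegral_cst// mul0r big_nil.
under eq_Rintegral do rewrite big_cons.
by rewrite big_cons RintegralD// ?ih//; exact: integrable_seg_sum.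
Qed.

Lemma normr_Rintegral_le a b f M : a <= b -> 
  mu.-integrable `[a, b] (EFin \o f) ->
  (forall x, x \in `[a, b] -> `|f x| <= M) ->
  `|\int[mu]_(x in `[a, b]) f x| <= M * (b - a).
Proof.
move=> ab fi fM; apply: le_trans (le_normr_Rintegral _ fi) _ => //.
have -> : M * (b - a) = \int[mu]_(x in `[a, b]) M.
  by rewrite Rintegral_cst//; congr (_ * _); exact/esym/seg_length.
apply: le_Rintegral => //.
- have := integrable_norm fi; exact.
- by apply: (@bounded_integrable _ _ _ `|M|).
Qed.

Lemma Rintegral_FTC2 a b f F : a < b ->
  (forall x, x \in `[a, b] -> {for x, continuous f}) ->
  (forall x : R, x \in `[a, b] -> is_derive x (1 : R) F (f x)) ->
  mu.-integrable `[a, b] (EFin \o f) /\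
  \int[mu]_(x in `[a, b]) f x = F b - F a.
Proof.
move=> ab cf dF.
have wf : {within `[a, b], continuous f}.
  by apply: continuous_in_subspaceT => x; rewrite inE/=; exact: cf.
split; first by apply: continuous_compact_integrable => //; exact: segment_compact.
have aab : a \in `[a, b] by rewrite in_itv/= lexx ltW.
have bab : b \in `[a, b] by rewrite in_itv/= lexx ltW.
have cF x : x \in `[a, b] -> {for x, continuous F}.
  by move=> xab; apply/differentiable_continuous/derivable1_diffP; have [] := dF x xab.
rewrite /Rintegral (@continuous_FTC2 _ f F)//.
- split; first by move=> x /subset_itv_oo_cc xab; have [] := dF x xab.
  + by apply: cvg_at_right_filter; exact: cF.
  + by apply: cvg_at_left_filter; exact: cF.
- by move=> x /subset_itv_oo_cc xab; rewrite derive1E; have [] := dF x xab.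
Qed.

Lemma dominated_Rintegral a b (f_ : nat -> R -> R) f g :
  (forall n, measurable_fun `[a, b] (f_ n)) ->
  mu.-integrable `[a, b] (EFin \o g) ->
  (forall n x, x \in `[a, b] -> `|f_ n x| <= g x) ->
  {ae mu, forall x, `[a, b]%classic x -> f_ n x @[n --> \oo] --> f x} ->
  measurable_fun `[a, b] f ->
  \int[mu]_(x in `[a, b]) f_ n x @[n --> \oo] --> \int[mu]_(x in `[a, b]) f x.
Proof.
move=> mf_ gi f_g f_f mf.
have [] := @dominated_convergence _ _ _ mu `[a, b]%classic (measurable_itv _)
  (fun n => EFin \o f_ n) (EFin \o f) (EFin \o g).
- by move=> n; apply/measurable_EFinP; exact: mf_.
- exact/measurable_EFinP.
- move: f_f; apply: filterS; first exact: (ae_filter_ringOfSetsType mu).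
  by move=> x h xD; apply/fine_cvgP; split; [exact: nearW|exact: h].
- exact: gi.
- by apply: aeW => x n xD /=; rewrite lee_fin; apply: f_g.
move=> fi _ h; apply/fine_cvg; rewrite fineK; last exact: integrable_fin_num.
exact: h.
Qed.

End RealIntegrals.

Section ComplexIntegrals.
Context {R : realType}.
Notation mu := (@lebesgue_measure R).
Implicit Types (f g : R -> R[i]) (a b M : R) (c : R[i]).

Definition Cintegrable a b f :=
  mu.-integrable `[a, b] (EFin \o (fun x => complex.Re (f x))) /\
  mu.-integrable `[a, b] (EFin \o (fun x => complex.Im (f x))).

Definition Cmeasurable f :=
  measurable_fun setT (fun x => complex.Re (f x)) /\
  measurable_fun setT (fun x => complex.Im (f x)).

(** A class closed under sums, products and conjugation whose members are integrable on every
    segment; integrability alone is not preserved by products. *)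
Definition bounded_measurable f :=
  Cmeasurable f /\ exists M, forall x, normc (f x) <= M.

Lemma CmeasurableD f g : Cmeasurable f -> Cmeasurable g ->
  Cmeasurable (fun x => f x + g x).
Proof.
move=> [f1 f2] [g1 g2]; split.
- by under eq_fun do rewrite cReD; exact: measurable_funD.
- by under eq_fun do rewrite cImD; exact: measurable_funD.
Qed.

Lemma CmeasurableM f g : Cmeasurable f -> Cmeasurable g ->
  Cmeasurable (fun x => f x * g x).
Proof.
move=> [f1 f2] [g1 g2]; split.
- by under eq_fun do rewrite cReM; apply: measurable_funB; exact: measurable_funM.
- by under eq_fun do rewrite cImM; apply: measurable_funD; exact: measurable_funM.
Qed.

Lemma Cmeasurable_conj f : Cmeasurable f -> Cmeasurable (fun x => (conjc (f x))).
Proof.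
move=> [f1 f2]; split.
- by under eq_fun do rewrite Re_conjc.
- by under eq_fun do rewrite Im_conjc; exact: measurable_funN.
Qed.

Lemma bounded_measurable_cst c : bounded_measurable (fun=> c).
Proof. by split; [split; exact: measurable_cst|exists (normc c)]. Qed.

Lemma bounded_measurable_cexpi (p q : R) :
  bounded_measurable (fun x => cexpi (p * x + q)).
Proof.
have mpq : measurable_fun setT (fun x : R => p * x + q).
  by apply: measurable_funD => //; exact: measurable_funM.
split; last by exists 1 => x; rewrite normc_cexpi.
split; apply: measurableT_comp mpq; apply: continuous_measurable_fun.
- exact: continuous_cos.
- exact: continuous_sin.
Qed.

Lemma bounded_measurableD f g : bounded_measurable f -> bounded_measurable g ->
  bounded_measurable (fun x => f x + g x).
Proof.
move=> [mf [M fM]] [mg [N gN]]; split; first exact: CmeasurableD.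
by exists (M + N) => x; rewrite (le_trans (le_normcD _ _))// lerD.
Qed.

Lemma bounded_measurableM f g : bounded_measurable f -> bounded_measurable g ->
  bounded_measurable (fun x => f x * g x).
Proof.
move=> [mf [M fM]] [mg [N gN]]; split; first exact: CmeasurableM.
by exists (M * N) => x; rewrite normcM ler_pM ?normc_ge0.
Qed.

Lemma bounded_measurable_conj f : bounded_measurable f ->
  bounded_measurable (fun x => (conjc (f x))).
Proof.
move=> [mf [M fM]]; split; first exact: Cmeasurable_conj.
by exists M => x; rewrite normc_conj.
Qed.

Lemma bounded_measurableB f g :
  bounded_measurable f -> bounded_measurable g ->
  bounded_measurable (fun x => f x - g x).
Proof.
move=> bf bg; have := bounded_measurableD bf (bounded_measurableM (bounded_measurable_cst (-1)) bg).
by congr bounded_measurable; apply/funext => x; rewrite mulN1r.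
Qed.

Lemma bounded_measurable_sum I (r : seq I) (F : I -> R -> R[i]) :
  (forall i, bounded_measurable (F i)) ->
  bounded_measurable (fun x => \sum_(i <- r) F i x).
Proof.
move=> bF; elim: r => [|i r ih].
  by under eq_fun do rewrite big_nil; exact: bounded_measurable_cst.
by under eq_fun do rewrite big_cons; exact: bounded_measurableD.
Qed.

Lemma bounded_measurable_cubic f : bounded_measurable f ->
  bounded_measurable (cubic f).
Proof.
move=> bf; rewrite (_ : cubic f = fun x => f x * conjc (f x) * f x).
  apply: bounded_measurableM => //; apply: bounded_measurableM => //.
  exact: bounded_measurable_conj.
by apply/funext => x; exact: cubicE.
Qed.

Lemma bounded_Cintegrable a b f : bounded_measurable f -> Cintegrable a b f.
Proof.
move=> [[f1 f2] [M fM]]; split; apply: (@bounded_integrable _ _ _ _ M) => // x.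
- exact: le_trans (normRe_le _) _.
- exact: le_trans (normIm_le _) _.
Qed.

Lemma CintegrableM a b f g : Cintegrable a b f -> bounded_measurable g ->
  Cintegrable a b (fun x => f x * g x).
Proof.
move=> [f1 f2] [[g1 g2] [M gM]].
have gR x : `|complex.Re (g x)| <= M by exact: le_trans (normRe_le _) _.
have gI x : `|complex.Im (g x)| <= M by exact: le_trans (normIm_le _) _.
split.
- under [X in _ \o X]eq_fun do rewrite cReM.
  exact: integrable_segB (integrable_mul_bounded f1 g1 gR)
    (integrable_mul_bounded f2 g2 gI).
- under [X in _ \o X]eq_fun do rewrite cImM.
  exact: integrable_segD (integrable_mul_bounded f1 g2 gI)
    (integrable_mul_bounded f2 g1 gR).
Qed.

Lemma CintegrableD a b f g : Cintegrable a b f -> Cintegrable a b g ->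
  Cintegrable a b (fun x => f x + g x).
Proof.
move=> [f1 f2] [g1 g2]; split.
- under [X in _ \o X]eq_fun do rewrite cReD.
  exact: integrable_segD f1 g1.
- under [X in _ \o X]eq_fun do rewrite cImD.
  exact: integrable_segD f2 g2.
Qed.

Lemma CintegrableZ a b c f : Cintegrable a b f ->
  Cintegrable a b (fun x => c * f x).
Proof.
move=> fi; under eq_fun do rewrite mulrC.
by apply: CintegrableM => //; exact: bounded_measurable_cst.
Qed.

Lemma CintegralD a b f g : Cintegrable a b f -> Cintegrable a b g ->
  Cintegral `[a, b] (fun x => f x + g x) = Cintegral `[a, b] f + Cintegral `[a, b] g.
Proof.
move=> [f1 f2] [g1 g2]; apply/eqP; rewrite eq_complex /=; apply/andP; split; apply/eqP.
- by under eq_Rintegral do rewrite cReD; rewrite RintegralD.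
- by under eq_Rintegral do rewrite cImD; rewrite RintegralD.
Qed.

Lemma CintegralZ a b c f : Cintegrable a b f ->
  Cintegral `[a, b] (fun x => c * f x) = c * Cintegral `[a, b] f.
Proof.
move=> [f1 f2]; case: c => p q.
apply/eqP; rewrite eq_complex /=; apply/andP; split; apply/eqP.
- under eq_Rintegral do rewrite cReM /=.
  by rewrite RintegralB ?RintegralZl//; exact: integrable_segZ.
- under eq_Rintegral do rewrite cImM /=.
  by rewrite RintegralD ?RintegralZl//; exact: integrable_segZ.
Qed.

Lemma Cintegral_sum a b I (r : seq I) (F : I -> R -> R[i]) :
  (forall i, Cintegrable a b (F i)) ->
  Cintegral `[a, b] (fun x => \sum_(i <- r) F i x) =
  \sum_(i <- r) Cintegral `[a, b] (F i).
Proof.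
move=> Fi; apply/eqP; rewrite eq_complex cRe_sum cIm_sum /=; apply/andP; split; apply/eqP.
- under eq_Rintegral do rewrite cRe_sum.
  by rewrite Rintegral_seg_sum// => i; have [] := Fi i.
- under eq_Rintegral do rewrite cIm_sum.
  by rewrite Rintegral_seg_sum// => i; have [] := Fi i.
Qed.

(** The factor 2 comes from estimating the real and imaginary parts separately; it reappears in the
    constants of all later coefficient bounds. *)
Lemma normc_Cintegral_le a b f M : a <= b -> Cintegrable a b f ->
  (forall x, x \in `[a, b] -> normc (f x) <= M) ->
  normc (Cintegral `[a, b] f) <= 2 * M * (b - a).
Proof.
move=> ab [f1 f2] fM; apply: le_trans (normc_le _) _.
rewrite -mulrA mulr_natl mulr2n; apply: lerD; apply: normr_Rintegral_le => // x xab.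
- by apply: le_trans (normRe_le _) _; exact: fM.
- by apply: le_trans (normIm_le _) _; exact: fM.
Qed.

End ComplexIntegrals.

(** * Fourier coefficients and trigonometric polynomials *)

Section Fourier.
Context {R : realType} (alpha : R).
Hypothesis alpha_gt0 : 0 < alpha.
Notation mu := (@lebesgue_measure R).
Notation P := (period alpha).
Notation freq := (freq alpha).
Notation coef := (fourier_coef alpha).
Implicit Types (f g : R -> R[i]) (M : R) (c : int -> R[i]) (k : int).

Lemma period_gt0 : 0 < P.
Proof. by rewrite /period divr_gt0// mulr_gt0// pi_gt0. Qed.
Let P0 := period_gt0.

Lemma freqD j k : freq (j + k) = freq j + freq k.
Proof. by rewrite /freq /Defs.freq intrD mulrDr. Qed.

Lemma freqN k : freq (- k) = - freq k.
Proof. by rewrite /Defs.freq mulrNz mulrN. Qed.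

Definition mode k (x : R) : R[i] := cexpi (freq k * x).

Lemma bounded_measurable_mode k : bounded_measurable (mode k).
Proof.
rewrite (_ : mode k = fun x => cexpi (freq k * x + 0)).
  exact: bounded_measurable_cexpi.
by apply/funext => x; rewrite addr0.
Qed.

Lemma Cintegrable_coef f k : Cintegrable 0 P f ->
  Cintegrable 0 P (fun x => f x * cexpi (- (freq k * x))).
Proof.
move=> fi; apply: CintegrableM => //.
rewrite (_ : (fun x => _) = fun x => cexpi (- freq k * x + 0)).
  exact: bounded_measurable_cexpi.
by apply/funext => x; rewrite addr0 mulNr.
Qed.

Lemma fourier_coefD f g k : Cintegrable 0 P f -> Cintegrable 0 P g ->
  coef (fun x => f x + g x) k = coef f k + coef g k.
Proof.
move=> fi gi; rewrite /fourier_coef -mulrDr -CintegralD; first last.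
- exact: Cintegrable_coef.
- exact: Cintegrable_coef.
by congr (_ * Cintegral _ _); apply/funext => x; rewrite mulrDl.
Qed.

Lemma fourier_coefZ (z : R[i]) f k : Cintegrable 0 P f ->
  coef (fun x => z * f x) k = z * coef f k.
Proof.
move=> fi; rewrite /fourier_coef mulrCA -(CintegralZ z); last exact: Cintegrable_coef.
by congr (_ * Cintegral _ _); apply/funext => x; rewrite mulrA.
Qed.

Lemma fourier_coefB f g k : Cintegrable 0 P f -> Cintegrable 0 P g ->
  coef (fun x => f x - g x) k = coef f k - coef g k.
Proof.
move=> fi gi; rewrite -[- coef g k]mulN1r -(fourier_coefZ (-1))//.
rewrite -fourier_coefD//; last exact: CintegrableZ.
have -> // : (fun x => f x - g x) = (fun x => f x + -1 * g x).
by apply/funext => x; rewrite mulN1r.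
Qed.

Lemma fourier_coef_sum I (r : seq I) (F : I -> R -> R[i]) k :
  (forall i, Cintegrable 0 P (F i)) ->
  coef (fun x => \sum_(i <- r) F i x) k = \sum_(i <- r) coef (F i) k.
Proof.
move=> Fi; rewrite /fourier_coef -mulr_sumr -Cintegral_sum; last first.
  by move=> i; exact: Cintegrable_coef.
by congr (_ * Cintegral _ _); apply/funext => x; rewrite mulr_suml.
Qed.

Lemma normc_fourier_coef_le f k M : Cintegrable 0 P f ->
  (forall x, x \in `[0, P] -> normc (f x) <= M) -> normc (coef f k) <= 2 * M.
Proof.
move=> fi fM; rewrite normcM normcC gtr0_norm ?invr_gt0// mulrC ler_pdivrMr//.
rewrite -[X in _ * X]subr0; apply: normc_Cintegral_le; first exact: ltW.
- exact: Cintegrable_coef.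
- by move=> x xP; rewrite normcM normc_cexpi mulr1 fM.
Qed.

Lemma alpha_period : alpha * P = 2 * pi.
Proof. by rewrite /period mulrCA divff ?mulr1// gt_eqF. Qed.

Lemma mode_period k x : mode k (x + P) = mode k x.
Proof.
rewrite /mode -[RHS](cexpi_period_int _ k) -alpha_period /Defs.freq.
by congr cexpi; ring.
Qed.

Lemma Cintegral_mode k : Cintegral `[0, P] (mode k) = ((k == 0)%:R * P)%:C.
Proof.
have [->|k0] := eqVneq k 0.
  apply/eqP; rewrite eq_complex /= mul1r; apply/andP; split; apply/eqP.
    under eq_Rintegral do rewrite /Defs.freq mulr0 mul0r cos0.
    by rewrite Rintegral_cst// mul1r seg_length ?subr0// ltW.
  under eq_Rintegral do rewrite /Defs.freq mulr0 mul0r sin0.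
  by rewrite Rintegral_cst// mul0r.
have w0 : freq k != 0 by rewrite mulf_neq0 ?intr_eq0// gt_eqF.
have := mode_period k 0; rewrite add0r => /eqP; rewrite eq_complex /= mulr0 => /andP[/eqP ce /eqP se].
have cw (h : R -> R) : continuous h -> continuous (fun x => h (freq k * x)).
  move=> ch x; apply: continuous_comp; last exact: ch.
  by apply: cvgM; [exact: cvg_cst|exact: cvg_id].
rewrite mul0r; apply/eqP; rewrite eq_complex /=; apply/andP; split; apply/eqP.
- have dF (x : R) : is_derive x (1 : R) (fun y : R => (freq k)^-1 * sin (freq k * y))
      (cos (freq k * x)).
    by apply: is_derive_eq; rewrite /GRing.scale/=; field.
  rewrite (Rintegral_FTC2 P0 (fun x _ => cw _ (@continuous_cos R) x) (fun x _ => dF x)).2.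
  by rewrite se mulr0 sin0 subrr.
- have dF (x : R) : is_derive x (1 : R) (fun y : R => - (freq k)^-1 * cos (freq k * y))
      (sin (freq k * x)).
    by apply: is_derive_eq; rewrite /GRing.scale/=; field.
  rewrite (Rintegral_FTC2 P0 (fun x _ => cw _ (@continuous_sin R) x) (fun x _ => dF x)).2.
  by rewrite ce mulr0 cos0 subrr.
Qed.

Lemma fourier_coef_mode j k : coef (mode j) k = (j == k)%:R.
Proof.
rewrite /fourier_coef (_ : (fun x => _) = mode (j - k)).
  rewrite Cintegral_mode subr_eq0 -rmorphM /= mulrC -mulrA divff ?mulr1 ?(gt_eqF P0)//.
  by case: (j == k).
by apply/funext => x; rewrite /mode -cexpiD freqD freqN mulrDl mulNr.
Qed.

Definition trig_poly c L x : R[i] := \sum_(k <- box L) c k * mode k x.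

Lemma bounded_measurable_trig c L : bounded_measurable (trig_poly c L).
Proof.
apply: bounded_measurable_sum => k; apply: bounded_measurableM.
- exact: bounded_measurable_cst.
- exact: bounded_measurable_mode.
Qed.

Lemma fourier_coef_trig c L k :
  coef (trig_poly c L) k = \sum_(j <- box L | j == k) c j.
Proof.
rewrite fourier_coef_sum; last first.
  move=> j; apply: CintegrableZ; apply: bounded_Cintegrable.
  exact: bounded_measurable_mode.
rewrite [RHS]big_mkcond; apply: eq_bigr => j _.
rewrite fourier_coefZ ?fourier_coef_mode; last first.
  exact/bounded_Cintegrable/bounded_measurable_mode.
by case: ifP => _; rewrite ?mulr1 ?mulr0.
Qed.

Lemma fourier_coef_trig_in c L k : (`|k| <= L)%N -> coef (trig_poly c L) k = c k.
Proof. by move=> kL; rewrite fourier_coef_trig (big_box_pred1 c). Qed.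

Lemma normc_mode k x : normc (mode k x) = 1.
Proof. exact: normc_cexpi. Qed.

Lemma normc_trig_le c L x : normc (trig_poly c L x) <= \sum_(k <- box L) normc (c k).
Proof.
apply: le_trans (normc_sum _ _ _) _.
by apply: ler_sum => k _; rewrite normcM normc_mode mulr1.
Qed.

Lemma conj_mode k x : conjc (mode k x) = mode (- k) x.
Proof. by rewrite /mode conj_cexpi freqN mulNr. Qed.

(** The product of the modes [a], [- b] and [d] is the mode [a - b + d], and orthonormality keeps
    exactly the resonant triples. *)
Lemma fourier_coef_cubic_trig c L k :
  coef (cubic (trig_poly c L)) k = cubic_conv c L k.
Proof.
rewrite (_ : cubic _ = (fun x => \sum_(a <- box L) \sum_(b <- box L)
    \sum_(d <- box L) c a * conjc (c b) * c d * mode (a - b + d) x)); last first.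
  apply/funext => x; rewrite cubicE /trig_poly conjc_sum -mulrA mulr_suml.
  apply: eq_bigr => a _; rewrite mulr_suml mulr_sumr.
  apply: eq_bigr => b _; rewrite mulr_sumr mulr_sumr.
  apply: eq_bigr => d _; rewrite conjcM conj_mode.
  rewrite (_ : mode (a - b + d) x = mode a x * mode (- b) x * mode d x); first by ring.
  by rewrite /mode !freqD !mulrDl !cexpiD.
have bm z j : bounded_measurable (fun x => z * mode j x).
  by apply: bounded_measurableM; [exact: bounded_measurable_cst|exact: bounded_measurable_mode].
rewrite fourier_coef_sum; last first.
  move=> a; apply: bounded_Cintegrable; apply: bounded_measurable_sum => b.
  exact: bounded_measurable_sum.
apply: eq_bigr => a _; rewrite fourier_coef_sum; last first.
  by move=> b; apply: bounded_Cintegrable; exact: bounded_measurable_sum.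
apply: eq_bigr => b _; rewrite fourier_coef_sum; last first.
  by move=> d; exact: bounded_Cintegrable.
rewrite [RHS]big_mkcond; apply: eq_bigr => d _.
rewrite fourier_coefZ ?fourier_coef_mode; last first.
  exact/bounded_Cintegrable/bounded_measurable_mode.
rewrite (_ : (a + d == b + k) = (a - b + d == k)); last by lia.
by case: ifP => _; rewrite ?mulr1 ?mulr0.
Qed.

End Fourier.

(** * Completeness of the trigonometric system *)

Section StepPolynomials.
Context {R : realType}.
Implicit Types (z t : R).

Lemma bernoulli_ge t n : 0 <= t -> t <= 1 -> 1 - n%:R * t <= (1 - t) ^+ n.
Proof.
move=> t0 t1; elim: n => [|n ih]; first by rewrite mul0r subr0.
rewrite exprS -natr1; apply: le_trans (ler_wpM2l _ ih); last by rewrite subr_ge0.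
have : 0 <= n%:R * (t * t) :> R by rewrite !mulr_ge0.
by nra.
Qed.

(** Combines [n t <= (1 + t)^n] with [(1 - t^2)^n <= 1]. *)
Lemma bernoulli_le t n : 0 <= t -> t <= 1 -> (1 - t) ^+ n * (n%:R * t) <= 1.
Proof.
move=> t0 t1.
have h : n%:R * t <= (1 + t) ^+ n.
  elim: n => [|n ih]; first by rewrite mul0r expr0.
  have : 1 <= (1 + t) ^+ n by rewrite exprn_ege1// lerDl.
  rewrite exprS -natr1; move: ih; set p := _ ^+ _ => ih p1.
  have : t <= t * p by rewrite ler_peMr.
  by nra.
apply: le_trans (ler_wpM2l _ h) _; first by rewrite exprn_ge0// subr_ge0.
by rewrite -exprMn exprn_ile1//; nra.
Qed.

(** These polynomials tend on [0, 1] to a step at 1/2, as in the Brosowski-Deutsch proof of the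
    Stone-Weierstrass theorem. The Bernoulli bounds compare them with [2 ^ n * z ^ n = (2 * z) ^ n],
    which tends to 0 below 1/2 and to infinity above. *)
Lemma step_poly_lt z : 0 <= z -> z < 2^-1 ->
  (1 - z ^+ n) ^+ (2 ^ n) @[n --> \oo] --> (1 : R).
Proof.
move=> z0 z2.
apply: (@squeeze_cvgr _ _ _ _ (fun n => 1 - (2 * z) ^+ n) (fun=> 1)); last exact: cvg_cst.
  near=> n; apply/andP; split.
    rewrite exprMn -natrX; apply: bernoulli_ge; first exact: exprn_ge0.
    by apply: exprn_ile1 => //; lra.
  by apply: exprn_ile1; rewrite ?lerBlDr ?lerDl ?exprn_ge0// subr_ge0 exprn_ile1//; lra.
rewrite -[X in _ --> X]subr0; apply: cvgB; first exact: cvg_cst.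
by apply: cvg_expr; rewrite ger0_norm; lra.
Unshelve. all: by end_near. Qed.

Lemma step_poly_gt z : 2^-1 < z -> z <= 1 ->
  (1 - z ^+ n) ^+ (2 ^ n) @[n --> \oo] --> (0 : R).
Proof.
move=> z2 z1; have z0 : 0 < z by lra.
have zn n : 0 <= 1 - z ^+ n by rewrite subr_ge0 exprn_ile1// ltW.
apply: (@squeeze_cvgr _ _ _ _ (fun=> 0) (fun n => ((2 * z)^-1) ^+ n)); first last.
- apply: cvg_expr; rewrite ger0_norm ?invr_ge0; last by lra.
  by rewrite invf_lt1; lra.
- exact: cvg_cst.
near=> n; rewrite exprn_ge0//=.
rewrite exprVn -[X in _ <= X]mul1r ler_pdivlMr ?exprn_gt0; last by lra.
rewrite exprMn -natrX; apply: bernoulli_le; first exact/exprn_ge0/ltW.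
by apply: exprn_ile1 => //; lra.
Unshelve. all: by end_near. Qed.

End StepPolynomials.

Section Uniqueness.
Context {R : realType} (alpha : R).
Hypothesis alpha_gt0 : 0 < alpha.
Notation mu := (@lebesgue_measure R).
Notation P := (period alpha).
Notation freq := (freq alpha).
Let P0 : 0 < P := period_gt0 alpha_gt0.

Variable phi : R -> R.
Hypothesis mphi : measurable_fun setT phi.
Hypothesis iphi : mu.-integrable `[0, P] (EFin \o phi).
Hypothesis phi_orth : forall k theta,
  \int[mu]_(y in `[0, P]) (phi y * cos (freq k * y + theta)) = 0.

Let mcos p q : measurable_fun setT (fun y : R => cos (p * y + q)).
Proof.
have mpq : measurable_fun setT (fun x : R => p * x + q).
  by apply: measurable_funD => //; exact: measurable_funM.
by apply: measurableT_comp mpq; apply: continuous_measurable_fun; exact: continuous_cos.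
Qed.

Let mcosB c n : measurable_fun setT (fun y : R => cos (alpha * (y - c)) ^+ n).
Proof.
apply: measurable_funX; have := mcos alpha (- (alpha * c)).
by apply: eq_measurable_fun => y _; congr cos; ring.
Qed.

Let norm_cos_le1 n (x : R) : `|cos x ^+ n| <= 1.
Proof. by rewrite normrX exprn_ile1// cos_max. Qed.

Let phi_cos_integrable c n :
  mu.-integrable `[0, P] (EFin \o (fun y => phi y * cos (alpha * (y - c)) ^+ n)).
Proof. exact: (integrable_mul_bounded iphi (mcosB c n) (fun=> norm_cos_le1 _ _)). Qed.

Let cos_le1' (x : R) : `|cos x| <= 1. Proof. exact: cos_max. Qed.

(** By the product-to-sum formula a factor [cos (alpha * (y - c))] moves [k] by one in both
    directions and shifts the phase; this is why the induction runs over all [k] and [theta] at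
    once. *)
Let orth_cos_pow c n k theta :
  \int[mu]_(y in `[0, P])
    (phi y * cos (alpha * (y - c)) ^+ n * cos (freq k * y + theta)) = 0.
Proof.
elim: n k theta => [|n ih] k theta.
  by under eq_Rintegral do rewrite expr0 mulr1; exact: phi_orth.
transitivity (\int[mu]_(y in `[0, P]) (2^-1 *
    (phi y * cos (alpha * (y - c)) ^+ n * cos (freq (k + 1) * y + (theta - alpha * c)) +
     phi y * cos (alpha * (y - c)) ^+ n * cos (freq (k - 1) * y + (theta + alpha * c))))).
  apply: eq_Rintegral => y _; rewrite exprS.
  have -> : freq (k + 1) * y + (theta - alpha * c) = (freq k * y + theta) + alpha * (y - c).
    by rewrite freqD /Defs.freq; ring.
  have -> : freq (k - 1) * y + (theta + alpha * c) = (freq k * y + theta) - alpha * (y - c).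
    by rewrite freqD freqN /Defs.freq; ring.
  by move: (freq k * y + theta) => u; rewrite cosD cosB; field.
have ii j t : mu.-integrable `[0, P] (EFin \o (fun y =>
    phi y * cos (alpha * (y - c)) ^+ n * cos (freq j * y + t))).
  exact: (integrable_mul_bounded (phi_cos_integrable c n) (mcos _ _) (fun=> cos_le1' _)).
rewrite RintegralZl//; last exact: integrable_segD.
by rewrite RintegralD// !ih addr0 mulr0.
Qed.

Let orth_cos_poly c (p : {poly R}) :
  \int[mu]_(y in `[0, P]) (phi y * p.[cos (alpha * (y - c))]) = 0.
Proof.
transitivity (\int[mu]_(y in `[0, P]) (\sum_(i < size p)
    p`_i * (phi y * cos (alpha * (y - c)) ^+ i))).
  apply: eq_Rintegral => y _; rewrite horner_coef mulr_sumr.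
  by apply: eq_bigr => i _; ring.
rewrite Rintegral_seg_sum; last by move=> i; exact: integrable_segZ.
rewrite big1// => i _; rewrite RintegralZl//.
have := orth_cos_pow c i 0 0.
under eq_Rintegral do rewrite /Defs.freq mulr0 mul0r addr0 cos0 mulr1.
by move=> ->; rewrite mulr0.
Qed.

(** With [c] the midpoint of [[0, x]], inside the period [cos (alpha * (y - c))] exceeds its common
    value [r] at the two ends exactly for [0 < y < x]. The affine polynomial [q] turns this cosine
    into [z y], with values in [0, 1] and below 1/2 exactly there, so the step polynomials [p n]
    tend to the indicator of [[0, x]] almost everywhere; each of them is orthogonal to [phi]. *)
Let integral_initial_segment (x : R) : 0 < x -> x < P ->
  \int[mu]_(y in `[0, P]) (phi y * (y <= x)%R%:R) = 0.
Proof.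
move=> x0 xP; pose c := x / 2; pose r := cos (alpha * c).
pose q : {poly R} := (2^-1)%:P - (4^-1) *: ('X - r%:P).
pose p n : {poly R} := (1 - q ^+ n) ^+ (2 ^ n).
pose z y := 2^-1 - 2^-1 * (sin (alpha * y / 2) * sin (alpha * (x - y) / 2)).
have pE n y : (p n).[cos (alpha * (y - c))] = (1 - z y ^+ n) ^+ (2 ^ n).
  rewrite /p horner_exp hornerD hornerN horner_exp hornerC.
  congr ((_ - _ ^+ _) ^+ _).
  rewrite /q !hornerE /z /r /c.
  have -> : alpha * (y - x / 2) = alpha * y / 2 - alpha * (x - y) / 2 by field.
  have -> : alpha * (x / 2) = alpha * y / 2 + alpha * (x - y) / 2 by field.
  by rewrite cosB cosD; field.
have sin2 (u v : R) : `|sin u * sin v| <= 1.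
  by rewrite normrM -[leRHS]mul1r ler_pM ?sin_max.
have z01 y : 0 <= z y <= 1.
  have /ler_normlP[h1 h2] := sin2 (alpha * y / 2) (alpha * (x - y) / 2).
  by rewrite /z; lra.
have p01 n y : `|(p n).[cos (alpha * (y - c))]| <= 1.
  have /andP[zy0 zy1] := z01 y.
  have h : 0 <= 1 - z y ^+ n by rewrite subr_ge0 exprn_ile1.
  rewrite pE ger0_norm ?exprn_ge0// exprn_ile1//.
  by rewrite lerBlDr lerDl exprn_ge0.
have mp n : measurable_fun setT (fun y : R => (p n).[cos (alpha * (y - c))]).
  apply: (@eq_measurable_fun _ _ _ _ _ (fun y : R =>
    \sum_(i < size (p n)) (p n)`_i * cos (alpha * (y - c)) ^+ i)).
    by move=> y _; rewrite horner_coef.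
  by apply: measurable_sum => i; exact: measurable_funM.
have mle : measurable_fun setT (fun y : R => (y <= x)%R%:R : R).
  have -> : (fun y : R => (y <= x)%R%:R : R) = \1_(`]-oo, x]%classic : set R).
    by apply/funext => y; rewrite indicE mem_setE in_itv/=.
  exact: measurable_indic.
suff h : \int[mu]_(y in `[0, P]) (phi y * (p n).[cos (alpha * (y - c))]) @[n --> \oo]
    --> \int[mu]_(y in `[0, P]) (phi y * (y <= x)%R%:R).
  move: h.
  have -> : (fun n => \int[mu]_(y in `[0, P]) (phi y * (p n).[cos (alpha * (y - c))])) = fun=> 0.
    by apply/funext => n; exact: orth_cos_poly.
  by move/(cvg_lim (@Rhausdorff R)) <-; exact: lim_cst.
apply: (@dominated_Rintegral R 0 P _ _ (fun y => `|phi y|)).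
- by move=> n; apply: measurable_funS (measurable_funM mphi (mp n)).
- exact: integrable_norm.
- by move=> n y _; rewrite normrM -[leRHS]mulr1 ler_pM.
(* At these three points one of the two sines vanishes and [z y] equals 1/2, where the step
   polynomials are not controlled. *)
- have : mu.-negligible [set 0; P; x].
    exists [set 0; P; x]; split => //.
    + by apply: measurableU => //; apply: measurableU.
    + by apply: countable_lebesgue_measure0; apply: finite_set_countable.
  apply: negligibleS => y /= /not_implyP[]; rewrite in_itv/= => /andP[y0 yP] ncvg.
  apply: contrapT => yN; apply: ncvg.
  have yn0 : y != 0 by apply/eqP => e; apply: yN; left; left.
  have ynP : y != P by apply/eqP => e; apply: yN; left; right.
  have ynx : y != x by apply/eqP => e; apply: yN; right.
  apply: cvgM; first exact: cvg_cst.
  under eq_fun do rewrite pE.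
  have y_gt0 : 0 < y by rewrite lt_neqAle eq_sym yn0.
  have y_ltP : y < P by rewrite lt_neqAle ynP.
  have aP : alpha * P = 2 * pi by exact: alpha_period.
  have s1 : 0 < sin (alpha * y / 2).
    apply: sin_gt0_pi; rewrite divr_gt0 ?mulr_gt0//=.
    by have : alpha * y < alpha * P by [rewrite ltr_pM2l//]; rewrite aP; lra.
  have /andP[zy0 zy1] := z01 y.
  have [yx|xy|yx] := ltgtP y x; last by rewrite yx eqxx in ynx.
  + apply: step_poly_lt => //; rewrite /z.
    have s2 : 0 < sin (alpha * (x - y) / 2).
      apply: sin_gt0_pi; rewrite divr_gt0 ?mulr_gt0 ?subr_gt0//=.
      have : alpha * (x - y) < alpha * P by rewrite ltr_pM2l//; lra.
      by rewrite aP; lra.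
    by have := mulr_gt0 s1 s2; lra.
  + apply: step_poly_gt => //; rewrite /z.
    have s2 : 0 < sin (alpha * (y - x) / 2).
      apply: sin_gt0_pi; rewrite divr_gt0 ?mulr_gt0 ?subr_gt0//=.
      have : alpha * (y - x) < alpha * P by rewrite ltr_pM2l//; lra.
      by rewrite aP; lra.
    have -> : alpha * (x - y) / 2 = - (alpha * (y - x) / 2) by field.
    by rewrite sinN; have := mulr_gt0 s1 s2; lra.
- by apply: measurable_funS (measurable_funM mphi mle).
Qed.

(** The primitive of [phi], extended by zero, vanishes on the open period, and Lebesgue
    differentiation recovers [phi] from it almost everywhere. *)
Lemma orthogonal_modes_ae0 : {ae mu, forall x, `[0, P]%classic x -> phi x = 0}.
Proof.
pose phi0 := phi \_ `[0, P]%classic.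
have mphi0 : measurable_fun setT phi0.
  by apply/(measurable_restrictT _ _).1 => //; exact: measurable_funS mphi.
have iphi0 : mu.-integrable setT (EFin \o phi0).
  by rewrite /phi0 -restrict_EFin -integrable_mkcond.
pose F x := \int[mu]_(t in `]-oo, x]) phi0 t.
have F0 x : 0 < x -> x < P -> F x = 0.
  move=> x0 xP; rewrite -(integral_initial_segment x0 xP) /F.
  rewrite Rintegral_mkcond [RHS]Rintegral_mkcond; apply: eq_Rintegral => y _.
  rewrite /phi0 !patchE; case: (y \in `[0, P]%classic); last by case: ifP.
  rewrite mem_setE in_itv/=.
  by case: ifP => _; rewrite ?mulr1 ?mulr0.
have loc : locally_integrable setT phi0 by exact: integrable_locally.
have iphi0Ny y : mu.-integrable `]-oo, y] (EFin \o phi0) by exact: integrableS iphi0.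
have ends : {ae mu, forall x : R, x != 0 /\ x != P}.
  exists [set 0; P]; split => //; first by apply: measurableU.
    by apply: countable_lebesgue_measure0; apply: finite_set_countable.
  move=> x /= /not_andP[] /negP; rewrite negbK => /eqP ->; [by left|by right].
move: (FTC1Ny iphi0Ny loc) ends; apply: filterS2; first exact: (ae_filter_ringOfSetsType mu).
move=> x [_ dF] [xn0 xnP] /=; rewrite in_itv/= => /andP[x0 xP].
have {}x0 : 0 < x by rewrite lt_neqAle eq_sym xn0.
have {}xP : x < P by rewrite lt_neqAle xnP.
have <- : phi0 x = phi x by rewrite /phi0 patchE mem_setE in_itv/= !ltW.
rewrite -dF derive1E (@near_eq_derive _ _ _ _ (cst 0)) ?derive_cst//.
have : \forall y \near x, y \in `]0, P[ by apply: near_in_itvoo; rewrite in_itv/= x0.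
by apply: filterS => y; rewrite in_itv/= => /andP[y0 yP]; exact: F0.
Qed.

End Uniqueness.

(** * Absolutely convergent Fourier series *)

Section DominatedIncrements.
Context {R : realType}.
Implicit Types (a S : nat -> R).

(* The sum of the two sequences is nondecreasing and bounded. *)
Lemma dominated_increments a S (X : R) :
  (forall M L, (M <= L)%N -> `|a L - a M| <= S L - S M) ->
  (forall L, S L <= X) ->
  [/\ cvgn a, cvgn S & forall M, `|limn a - a M| <= limn S - S M].
Proof.
move=> aS SX.
have ndS : nondecreasing_seq S.
  by move=> M L ML; rewrite -subr_ge0 (le_trans _ (aS _ _ ML)).
have cS : cvgn S.
  apply: nondecreasing_is_cvgn => //.
  by exists X => _ [n _ <-].
have caS : cvgn (fun n => a n + S n).
  apply: nondecreasing_is_cvgn.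
    by move=> M L ML; have /ler_normlP[] := aS _ _ ML; lra.
  exists (a 0%N + 2 * X - S 0%N) => _ [n _ <-] /=.
  have /ler_normlP[] := aS 0%N n (leq0n _); have := SX n; lra.
have ca : cvgn a.
  rewrite (_ : a = (fun n => (a n + S n) - S n)); first exact: is_cvgB.
  by apply/funext => n; rewrite addrK.
split=> // M.
have c1 : `|a n - a M| @[n --> \oo] --> `|limn a - a M|.
  by apply: cvg_norm; apply: cvgB => //; exact: cvg_cst.
have c2 : S n - S M @[n --> \oo] --> limn S - S M.
  by apply: cvgB => //; exact: cvg_cst.
rewrite -(cvg_lim (@Rhausdorff R) c1) -(cvg_lim (@Rhausdorff R) c2).
apply: ler_lim; [by apply: cvgP c1|by apply: cvgP c2|].
by near=> n; apply: aS; near: n; exists M.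
Unshelve. all: by end_near. Qed.

End DominatedIncrements.

Section AbsoluteSums.
Context {R : realType}.
Implicit Types (c : int -> R[i]).

Definition abs_sum c L : R := \sum_(k <- box L) normc (c k).

Definition coef_tail c L : R := limn (abs_sum c) - abs_sum c L.

Lemma abs_sum_ge0 c L : 0 <= abs_sum c L.
Proof. by apply: sumr_ge0 => k _; exact: normc_ge0. Qed.

Lemma abs_sum_cvg c X : (forall L, abs_sum c L <= X) -> cvgn (abs_sum c).
Proof.
move=> cX; apply: nondecreasing_is_cvgn; last by exists X => _ [n _ <-].
by move=> M L; apply: le_sum_box => k; exact: normc_ge0.
Qed.

Lemma coef_tail_cvg0 c X : (forall L, abs_sum c L <= X) ->
  coef_tail c L @[L --> \oo] --> (0 : R).
Proof.
move=> /abs_sum_cvg cS; rewrite -(subrr (limn (abs_sum c))).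
by apply: cvgB => //; exact: cvg_cst.
Qed.

Lemma coef_tail_le c X L : (forall L, abs_sum c L <= X) ->
  coef_tail c L <= X - abs_sum c L.
Proof.
move=> cX; rewrite lerB//; apply: limr_le; last exact: nearW.
exact: abs_sum_cvg cX.
Qed.

End AbsoluteSums.

Section FourierSeries.
Context {R : realType} (alpha : R).
Hypothesis alpha_gt0 : 0 < alpha.
Notation mu := (@lebesgue_measure R).
Notation P := (period alpha).
Notation freq := (freq alpha).
Notation coef := (fourier_coef alpha).
Notation trig := (trig_poly alpha).
Let P0 : 0 < P := period_gt0 alpha_gt0.
Implicit Types (c d : int -> R[i]) (X D : R).

(** [limn] is total, so this is meaningful under absolute summability of [c], which accompanies it
    in the estimates. *)
Definition fourier_series c (x : R) : R[i] :=
  limn (fun n => complex.Re (trig c n x)) +i*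
  limn (fun n => complex.Im (trig c n x)).

(** Coefficients are continuous for uniform convergence, and the [k]-th one of the partial sums
    equals [c k] once [L] reaches [|k|]. This serves both abstract series and the breather, which is
    given in closed form. *)
Lemma uniform_trig_limit (f : R -> R[i]) c (delta : nat -> R) :
  (forall L x, normc (f x - trig c L x) <= delta L) ->
  delta L @[L --> \oo] --> (0 : R) ->
  bounded_measurable f /\ forall k, coef f k = c k.
Proof.
move=> fc d0.
have fcvg (p : R[i] -> R) x : (forall z w, p (z - w) = p z - p w) ->
    (forall z, `|p z| <= normc z) -> p (trig c L x) @[L --> \oo] --> p (f x).
  move=> pB pn; apply: (@squeeze_cvgr _ _ _ _ (fun L => p (f x) - delta L)
      (fun L => p (f x) + delta L)).
  - apply: nearW => L; have := le_trans (pn _) (fc L x).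
    by rewrite pB => /ler_normlP[]; lra.
  - by rewrite -[X in _ --> X]subr0; apply: cvgB => //; exact: cvg_cst.
  - by rewrite -[X in _ --> X]addr0; apply: cvgD => //; exact: cvg_cst.
have bf : bounded_measurable f.
  split; last first.
    have [_ [M Mt]] := bounded_measurable_trig alpha c 0.
    exists (delta 0%N + M) => x; rewrite -(subrK (trig c 0 x) (f x)).
    by apply: le_trans (le_normcD _ _) _; apply: lerD; [exact: fc|exact: Mt].
  split.
  - apply: (@measurable_fun_cvg _ _ _ _ (fun n x => complex.Re (trig c n x))).
      by move=> n; have [[]] := bounded_measurable_trig alpha c n.
    by move=> x _; apply: fcvg; [exact: cReB|exact: normRe_le].
  - apply: (@measurable_fun_cvg _ _ _ _ (fun n x => complex.Im (trig c n x))).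
      by move=> n; have [[]] := bounded_measurable_trig alpha c n.
    by move=> x _; apply: fcvg; [exact: cImB|exact: normIm_le].
split=> // k.
apply/eqP; rewrite -subr_eq0; apply/eqP/eq0_normc/eqP; rewrite eq_le normc_ge0 andbT.
have h : 2 * delta L @[L --> \oo] --> (0 : R).
  by rewrite -(mulr0 2); apply: cvgM => //; exact: cvg_cst.
rewrite -(cvg_lim (@Rhausdorff R) h).
apply: limr_ge; first by apply: cvgP h.
near=> L.
have kL : (`|k| <= L)%N by near: L; exists `|k|%N.
rewrite -(fourier_coef_trig_in alpha_gt0 c kL) -fourier_coefB; first last.
- exact/bounded_Cintegrable/bounded_measurable_trig.
- exact: bounded_Cintegrable.
apply: normc_fourier_coef_le => //.
by apply/bounded_Cintegrable/bounded_measurableB => //; exact: bounded_measurable_trig.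
Unshelve. all: by end_near. Qed.

Lemma trig_incr c M L x : (M <= L)%N ->
  normc (trig c L x - trig c M x) <= abs_sum c L - abs_sum c M.
Proof.
move=> ML; rewrite /trig /trig_poly /abs_sum -!(big_box_mask _ ML).
rewrite [X in normc (X - _)](bigID [in box M]) [X in _ <= X - _](bigID [in box M]) /=.
rewrite !(addrC _ (\sum_(k <- box L | k \notin box M) _)) !addrK.
apply: le_trans (normc_sum _ _ _) _.
by apply: ler_sum => k _; rewrite normcM normc_mode mulr1.
Qed.

Section Summable.
Variables (c : int -> R[i]) (X : R).
Hypothesis cX : forall L, abs_sum c L <= X.

Let re_incr x := @dominated_increments R (fun n => complex.Re (trig c n x)) (abs_sum c) X.
Let im_incr x := @dominated_increments R (fun n => complex.Im (trig c n x)) (abs_sum c) X.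

Let re_spec x : [/\ cvgn (fun n => complex.Re (trig c n x)), cvgn (abs_sum c) &
  forall M, `|complex.Re (fourier_series c x) - complex.Re (trig c M x)| <= coef_tail c M].
Proof.
apply: re_incr => // M L ML; rewrite -cReB.
exact: le_trans (normRe_le _) (trig_incr _ _ ML).
Qed.

Let im_spec x : [/\ cvgn (fun n => complex.Im (trig c n x)), cvgn (abs_sum c) &
  forall M, `|complex.Im (fourier_series c x) - complex.Im (trig c M x)| <= coef_tail c M].
Proof.
apply: im_incr => // M L ML; rewrite -cImB.
exact: le_trans (normIm_le _) (trig_incr _ _ ML).
Qed.

Lemma fourier_series_tail L x :
  normc (fourier_series c x - trig c L x) <= 2 * coef_tail c L.
Proof.
have [_ _ h1] := re_spec x; have [_ _ h2] := im_spec x.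
apply: le_trans (normc_le _) _; rewrite mulr_natl mulr2n cReB cImB.
by apply: lerD; [exact: h1|exact: h2].
Qed.

Lemma normc_trig_leX L x : normc (trig c L x) <= X.
Proof. exact: le_trans (normc_trig_le _ _ _ _) (cX L). Qed.

Lemma normc_fourier_series_le x : normc (fourier_series c x) <= 2 * X.
Proof.
rewrite -(subrK (trig c 0 x) (fourier_series c x)).
apply: le_trans (le_normcD _ _) _.
have := fourier_series_tail 0 x; have := coef_tail_le 0 cX.
have : normc (trig c 0 x) <= abs_sum c 0 by exact: normc_trig_le.
have := abs_sum_ge0 c 0; have := cX 0; lra.
Qed.

Let series_limit : bounded_measurable (fourier_series c) /\
  forall k, coef (fourier_series c) k = c k.
Proof.
apply: uniform_trig_limit fourier_series_tail _.
rewrite -(mulr0 2); apply: cvgM; first exact: cvg_cst.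
exact: coef_tail_cvg0 cX.
Qed.

Lemma bounded_measurable_fourier_series : bounded_measurable (fourier_series c).
Proof. exact: series_limit.1. Qed.

Lemma fourier_coef_series k : coef (fourier_series c) k = c k.
Proof. exact: series_limit.2. Qed.

End Summable.

End FourierSeries.

(** * The cubic term of an absolutely convergent series *)

Section CubicOfSeries.
Context {R : realType} (alpha : R).
Hypothesis alpha_gt0 : 0 < alpha.
Notation mu := (@lebesgue_measure R).
Notation P := (period alpha).
Notation freq := (freq alpha).
Notation coef := (fourier_coef alpha).
Notation trig := (trig_poly alpha).
Notation fs := (fourier_series alpha).
Let P0 : 0 < P := period_gt0 alpha_gt0.
Implicit Types (f g : R -> R[i]) (c d : int -> R[i]) (X D : R).

Lemma fourier_coef_cubic_lipschitz f g k (B D : R) :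
  bounded_measurable f -> bounded_measurable g ->
  (forall x, normc (f x) <= B) -> (forall x, normc (g x) <= B) ->
  (forall x, normc (f x - g x) <= D) ->
  normc (coef (cubic f) k - coef (cubic g) k) <= 6 * B ^+ 2 * D.
Proof.
move=> bf bg fB gB fgD; rewrite -fourier_coefB; first last.
- exact/bounded_Cintegrable/bounded_measurable_cubic.
- exact/bounded_Cintegrable/bounded_measurable_cubic.
rewrite (_ : 6 * B ^+ 2 * D = 2 * (3 * B ^+ 2 * D)); last by ring.
apply: normc_fourier_coef_le => //.
  by apply/bounded_Cintegrable/bounded_measurableB; exact: bounded_measurable_cubic.
move=> x _; rewrite !cubicE; apply: le_trans (normc_cube_le (fB x) (gB x)) _.
by rewrite ler_wpM2l// mulr_ge0// sqr_ge0.
Qed.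

Lemma cubic_conv_approx c X k L : (forall L, abs_sum c L <= X) ->
  normc (coef (cubic (fs c)) k - cubic_conv c L k) <= 48 * X ^+ 2 * coef_tail c L.
Proof.
move=> cX; rewrite -(fourier_coef_cubic_trig alpha_gt0).
rewrite (_ : 48 * _ * _ = 6 * (2 * X) ^+ 2 * (2 * coef_tail c L)); last by ring.
apply: fourier_coef_cubic_lipschitz.
- exact: (bounded_measurable_fourier_series alpha_gt0 cX).
- exact: bounded_measurable_trig.
- by move=> x; exact: normc_fourier_series_le.
- move=> x; apply: le_trans (normc_trig_leX alpha cX L x) _.
  by have := le_trans (abs_sum_ge0 c 0) (cX 0); lra.
- by move=> x; exact: (fourier_series_tail alpha cX).
Qed.

(** The uniform distance of the two series is bounded by the l^1 distance of their coefficients: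
    compare partial sums and let the tails vanish. This yields the continuity in time of the
    integrand in Duhamel's formula. *)
Lemma fourier_coef_cubic_series_lipschitz c d X D k :
  (forall L, abs_sum c L <= X) -> (forall L, abs_sum d L <= X) ->
  (forall L, abs_sum (fun k => c k - d k) L <= D) ->
  normc (coef (cubic (fs c)) k - coef (cubic (fs d)) k) <= 24 * X ^+ 2 * D.
Proof.
move=> cX dX cdD.
rewrite (_ : 24 * _ * _ = 6 * (2 * X) ^+ 2 * D); last by ring.
apply: fourier_coef_cubic_lipschitz.
- exact: (bounded_measurable_fourier_series alpha_gt0 cX).
- exact: (bounded_measurable_fourier_series alpha_gt0 dX).
- by move=> x; exact: normc_fourier_series_le.
- by move=> x; exact: normc_fourier_series_le.
move=> x.
have h : 2 * coef_tail c L + 2 * coef_tail d L + D @[L --> \oo] --> D.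
  rewrite -[X in _ --> X]add0r; apply: cvgD; last exact: cvg_cst.
  rewrite -(addr0 0); apply: cvgD; rewrite -(mulr0 2);
    by apply: cvgM; [exact: cvg_cst|exact: coef_tail_cvg0].
rewrite -(cvg_lim (@Rhausdorff R) h).
apply: limr_ge; first by apply: cvgP h.
near=> L.
rewrite (_ : fs c x - fs d x = (fs c x - trig c L x) - (fs d x - trig d L x)
   + (trig c L x - trig d L x)); last by ring.
apply: le_trans (le_normcD _ _) _; apply: lerD.
  apply: le_trans (le_normcB _ _) _.
  by apply: lerD; [exact: (fourier_series_tail alpha cX)|exact: (fourier_series_tail alpha dX)].
apply: le_trans (cdD L).
rewrite (_ : _ - _ = trig_poly alpha (fun k => c k - d k) L x); first exact: normc_trig_le.
by rewrite /trig_poly -sumrB; apply: eq_bigr => j _; rewrite mulrBl.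
Unshelve. all: by end_near. Qed.

Section Flux.
Variables (c : int -> R[i]) (X Y : R).
Hypothesis cX : forall L, abs_sum c L <= X.
Hypothesis cY : forall L, \sum_(k <- box L) `|freq k| * normc (c k) ^+ 2 <= Y.

(** Up to the factor -2, the time derivative of the momentum truncated to [box M]. *)
Definition flux M : R :=
  \sum_(k <- box M) freq k * complex.Im (coef (cubic (fs c)) k * conjc (c k)).

Let FB := flux_bound c freq.

Let FB_le L : FB L <= 3 * (X ^+ 2 * Y).
Proof. exact: (quad_weight_le (freqD alpha) (fun k => normc_ge0 (c k)) (cX L) (cY L)). Qed.

Let FB_cvg : cvgn FB.
Proof.
apply: nondecreasing_is_cvgn; first by move=> M L; exact: flux_bound_homo.
by exists (3 * (X ^+ 2 * Y)) => _ [n _ <-]; exact: FB_le.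
Qed.

(** [truncated_flux_le] with [L] tending to infinity at fixed [M]: replacing the true cubic
    coefficients by the convolution over [box L] costs [K * coef_tail c L], where [K] does not
    depend on [L]. *)
Let flux_le M : `|flux M| <= limn FB - FB M.
Proof.
pose K := \sum_(k <- box M) `|freq k| * (48 * X ^+ 2 * normc (c k)).
have h : K * coef_tail c L + (limn FB - FB M) @[L --> \oo] --> limn FB - FB M.
  rewrite -[X in _ --> X]add0r; apply: cvgD; last exact: cvg_cst.
  by rewrite -(mulr0 K); apply: cvgM; [exact: cvg_cst|exact: coef_tail_cvg0 cX].
rewrite -[leRHS](cvg_lim (@Rhausdorff R) h).
apply: limr_ge; first by apply: cvgP h.
near=> L.
have ML : (M <= L)%N by near: L; exists M.
rewrite -[flux M](subrK (\sum_(k <- box M) freq k * complex.Im (cubic_conv c L k * conjc (c k)))).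
apply: le_trans (ler_normD _ _) _; apply: lerD.
  rewrite /flux -sumrB mulr_suml; apply: le_trans (ler_norm_sum _ _ _) _.
  apply: ler_sum => k _; rewrite -mulrBr -cImB -mulrBl normrM -mulrA ler_wpM2l//.
  apply: le_trans (normIm_le _) _; rewrite normcM normc_conj mulrAC.
  by rewrite ler_wpM2r ?normc_ge0//; exact: cubic_conv_approx.
apply: le_trans (truncated_flux_le _ ML (freqD alpha)) _.
rewrite lerB//; apply: nondecreasing_cvgn_le => //.
by move=> ? ?; exact: flux_bound_homo.
Unshelve. all: by end_near. Qed.

Lemma flux_bounded M : `|flux M| <= 3 * (X ^+ 2 * Y).
Proof.
apply: le_trans (flux_le M) _.
have : limn FB <= 3 * (X ^+ 2 * Y) by apply: limr_le => //; exact: nearW.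
by have := flux_bound_ge0 c freq M; rewrite -/FB; lra.
Qed.

Lemma flux_cvg0 : flux M @[M --> \oo] --> (0 : R).
Proof.
have h : limn FB - FB M @[M --> \oo] --> (0 : R).
  by rewrite -(subrr (limn FB)); apply: cvgB => //; exact: cvg_cst.
apply: (@squeeze_cvgr _ _ _ _ (fun M => - (limn FB - FB M)) (fun M => limn FB - FB M)) => //.
  by apply: nearW => M; rewrite -ler_norml; exact: flux_le.
by rewrite -oppr0; exact: cvgN.
Qed.

End Flux.
End CubicOfSeries.

(** * Fourier inversion almost everywhere *)

Section FourierInversion.
Context {R : realType} (alpha : R).
Hypothesis alpha_gt0 : 0 < alpha.
Notation mu := (@lebesgue_measure R).
Notation P := (period alpha).
Notation freq := (freq alpha).
Notation coef := (fourier_coef alpha).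
Notation fs := (fourier_series alpha).
Let P0 : 0 < P := period_gt0 alpha_gt0.
Implicit Types (f g h : R -> R[i]).

Lemma square_integrable_Cintegrable f : Cmeasurable f ->
  (\int[mu]_(x in `[0%R, P]) (normc (f x) ^+ 2)%:E < +oo)%E -> Cintegrable 0 P f.
Proof.
move=> [mRe mIm] foo.
have mN : measurable_fun setT (fun x => normc (f x) ^+ 2).
  apply: (@eq_measurable_fun _ _ _ _ _ (fun x => complex.Re (f x) ^+ 2 + complex.Im (f x) ^+ 2)).
    by move=> x _; rewrite sqr_normcE.
  by apply: measurable_funD; exact: measurable_funX.
have iN : mu.-integrable `[0, P] (EFin \o (fun x => normc (f x) ^+ 2)).
  apply/integrableP; split.
    by apply/measurable_EFinP; exact: measurable_funS mN.
  under eq_integral => x _ do rewrite /= ger0_norm ?sqr_ge0//.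
  exact: foo.
have i1 : mu.-integrable `[0, P] (EFin \o (fun x => 1 + normc (f x) ^+ 2)).
  apply: integrable_segD => //; apply: (@bounded_integrable _ _ _ _ 1) => // x.
  by rewrite normr1.
have key (g : R -> R) : measurable_fun setT g -> (forall x, `|g x| <= normc (f x)) ->
    mu.-integrable `[0, P] (EFin \o g).
  move=> mg gf; apply: le_integrable i1 => //.
    by apply/measurable_EFinP; exact: measurable_funS mg.
  move=> x _; rewrite /= lee_fin; apply: le_trans (gf x) _.
  rewrite ger0_norm ?addr_ge0 ?sqr_ge0//.
  by have := sqr_ge0 (normc (f x) - 1); have := normc_ge0 (f x); nra.
split.
- exact: (key _ mRe (fun x => normRe_le (f x))).
- exact: (key _ mIm (fun x => normIm_le (f x))).
Qed.

(** One vanishing coefficient gives two real relations that mix [Re h] and [Im h]. Since the sine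
    integrals are odd in [k] and the cosine integrals even, the relations at [k] and [- k] together
    make all four integrals vanish. *)
Lemma fourier_coef0_orth h : Cintegrable 0 P h -> (forall k, coef h k = 0) ->
  forall k theta,
  \int[mu]_(y in `[0, P]) (complex.Re (h y) * cos (freq k * y + theta)) = 0 /\
  \int[mu]_(y in `[0, P]) (complex.Im (h y) * cos (freq k * y + theta)) = 0.
Proof.
move=> [hr hi] h0.
have mf (u : R -> R) k theta : continuous u ->
    measurable_fun setT (fun y => u (freq k * y + theta)).
  move=> cu; have mpq : measurable_fun setT (fun x : R => freq k * x + theta).
    by apply: measurable_funD => //; exact: measurable_funM.
  by apply: measurableT_comp mpq; exact: continuous_measurable_fun.
have ic u k theta : mu.-integrable `[0, P] (EFin \o u) ->
    mu.-integrable `[0, P] (EFin \o (fun y => u y * cos (freq k * y + theta))).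
  move=> iu; apply: (integrable_mul_bounded iu (mf _ k theta (@continuous_cos R)) (fun=> cos_max _)).
have is_ u k theta : mu.-integrable `[0, P] (EFin \o u) ->
    mu.-integrable `[0, P] (EFin \o (fun y => u y * sin (freq k * y + theta))).
  move=> iu; apply: (integrable_mul_bounded iu (mf _ k theta (@continuous_sin R)) (fun=> sin_max _)).
pose C u k := \int[mu]_(y in `[0, P]) (u y * cos (freq k * y + 0)).
pose S u k := \int[mu]_(y in `[0, P]) (u y * sin (freq k * y + 0)).
have CN u k : C u (- k) = C u k.
  apply: eq_Rintegral => y _; rewrite freqN mulNr -cosN opprD opprK.
  by rewrite oppr0.
have SN u k : mu.-integrable `[0, P] (EFin \o u) -> S u (- k) = - S u k.
  move=> iu; rewrite /S -[RHS]mulN1r -RintegralZl//; last exact: is_.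
  by apply: eq_Rintegral => y _; rewrite freqN mulNr -[X in _ + X]oppr0 -opprD sinN; ring.
have coefE k : C (fun y => complex.Re (h y)) k + S (fun y => complex.Im (h y)) k = 0 /\
    C (fun y => complex.Im (h y)) k - S (fun y => complex.Re (h y)) k = 0.
  have : Cintegral `[0, P] (fun x => h x * cexpi (- (freq k * x))) = 0.
    have /eqP := h0 k; rewrite mulf_eq0 => /orP[|/eqP //].
    by rewrite fmorph_eq0 invr_eq0 gt_eqF.
  move=> /eqP; rewrite eq_complex => /andP[/eqP e1 /eqP e2]; split.
  - rewrite -RintegralD//; [|exact: ic|exact: is_].
    rewrite -[RHS]e1; apply: eq_Rintegral => y _.
    by rewrite cReM /= cosN sinN addr0; ring.
  - rewrite -RintegralB//; [|exact: ic|exact: is_].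
    rewrite -[RHS]e2; apply: eq_Rintegral => y _.
    by rewrite cImM /= cosN sinN addr0; ring.
have CS0 k : [/\ C (fun y => complex.Re (h y)) k = 0, S (fun y => complex.Im (h y)) k = 0,
    C (fun y => complex.Im (h y)) k = 0 & S (fun y => complex.Re (h y)) k = 0].
  have [a1 a2] := coefE k; have [] := coefE (- k); rewrite !CN !SN// => b1 b2.
  by split; lra.
have fin u : mu.-integrable `[0, P] (EFin \o u) -> (forall k, C u k = 0) -> (forall k, S u k = 0) ->
    forall k theta, \int[mu]_(y in `[0, P]) (u y * cos (freq k * y + theta)) = 0.
  move=> iu Cu Su k theta.
  transitivity (cos theta * C u k - sin theta * S u k); last by rewrite Cu Su; ring.
  rewrite -!RintegralZl//; [|exact: is_|exact: ic].
  rewrite -RintegralB//; [|by apply: integrable_segZ; exact: ic|by apply: integrable_segZ; exact: is_].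
  by apply: eq_Rintegral => y _; rewrite addr0 cosD; ring.
move=> k theta; split; apply: fin => // j; have [] := CS0 j => //.
Qed.

Lemma fourier_coef0_ae0 h : Cmeasurable h -> Cintegrable 0 P h ->
  (forall k, coef h k = 0) -> {ae mu, forall x, `[0, P]%classic x -> h x = 0}.
Proof.
move=> [mR mI] ih h0; have [iR iI] := ih.
have orth := fourier_coef0_orth ih h0.
have r0 := orthogonal_modes_ae0 alpha_gt0 mR iR (fun k t => (orth k t).1).
have i0 := orthogonal_modes_ae0 alpha_gt0 mI iI (fun k t => (orth k t).2).
move: r0 i0; apply: filterS2; first exact: (ae_filter_ringOfSetsType mu).
move=> x /= hr hi xP; apply/eqP; rewrite eq_complex /=.
by rewrite hr// hi// !eqxx.
Qed.

Variables (f : R -> R[i]) (X : R).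
Hypotheses (mf : Cmeasurable f)
  (f2 : (\int[mu]_(x in `[0%R, P]) (normc (f x) ^+ 2)%:E < +oo)%E)
  (fX : forall L, abs_sum (coef f) L <= X).

Lemma fourier_inversion_ae :
  {ae mu, forall x, `[0, P]%classic x -> f x = fs (coef f) x}.
Proof.
have fi := square_integrable_Cintegrable mf f2.
have bs := bounded_measurable_fourier_series alpha_gt0 fX.
have bi : Cintegrable 0 P (fs (coef f)) by exact: bounded_Cintegrable.
have h0 : {ae mu, forall x, `[0, P]%classic x -> f x - fs (coef f) x = 0}.
  apply: fourier_coef0_ae0.
  - have [mbs _] := bs.
    have := CmeasurableD mf (CmeasurableM (bounded_measurable_cst (-1)).1 mbs).
    by congr Cmeasurable; apply/funext => x; rewrite mulN1r.
  - have := CintegrableD fi (CintegrableZ (-1) bi).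
    by congr Cintegrable; apply/funext => x; rewrite mulN1r.
  - by move=> k; rewrite fourier_coefB// (fourier_coef_series alpha_gt0 fX) subrr.
move: h0; apply: filterS; first exact: (ae_filter_ringOfSetsType mu).
by move=> x /= fx xP; apply/eqP; rewrite -subr_eq0 fx.
Qed.

(** Carries the cubic estimates, proved for the bounded series, over to an arbitrary measurable
    representative. *)
Lemma fourier_coef_cubic_series k : coef (cubic f) k = coef (cubic (fs (coef f))) k.
Proof.
have [mbs _] := bounded_measurable_fourier_series alpha_gt0 fX.
have mcub g : Cmeasurable g -> Cmeasurable (fun x => cubic g x * cexpi (- (freq k * x))).
  move=> mg; apply: CmeasurableM.
    rewrite (_ : cubic g = fun x => g x * conjc (g x) * g x).
      by apply: CmeasurableM => //; apply: CmeasurableM => //; exact: Cmeasurable_conj.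
    by apply/funext => x; exact: cubicE.
  rewrite (_ : (fun x => _) = fun x => cexpi (- freq k * x + 0)).
    by have [] := bounded_measurable_cexpi (- freq k) 0.
  by apply/funext => x; rewrite addr0 mulNr.
have [m1 m2] := mcub _ mf; have [m3 m4] := mcub _ mbs.
rewrite /fourier_coef; congr (_ * _); apply/eqP; rewrite eq_complex /=.
apply/andP; split; apply/eqP; congr fine.
- apply: ae_eq_integral => //.
  + by apply/measurable_EFinP; exact: measurable_funS m1.
  + by apply/measurable_EFinP; exact: measurable_funS m3.
  + move: fourier_inversion_ae; apply: filterS; first exact: (ae_filter_ringOfSetsType mu).
    by move=> x h xP; rewrite /cubic h.
- apply: ae_eq_integral => //.
  + by apply/measurable_EFinP; exact: measurable_funS m2.
  + by apply/measurable_EFinP; exact: measurable_funS m4.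
  + move: fourier_inversion_ae; apply: filterS; first exact: (ae_filter_ringOfSetsType mu).
    by move=> x h xP; rewrite /cubic h.
Qed.

End FourierInversion.

(** * Conservation of momentum *)

Section ModeEvolution.
Context {R : realType}.
Notation mu := (@lebesgue_measure R).

Lemma primitive_is_derive (f : R -> R) (a t : R) : continuous f -> a < t ->
  is_derive t (1 : R) (fun x : R => \int[mu]_(y in `[a, x]) f y) (f t).
Proof.
move=> cf ta.
have t1 : t < t + 1 by rewrite ltrDl.
have [] := @continuous_FTC1_closed R f a t (t + 1) t1 (continuous_integrable _ _ cf) ta (cf t).
by move=> dF; rewrite derive1E => <-; exact: derivableP.
Qed.

(** After multiplication by the phase [cexpi ((t - t0) * w)] Duhamel's formula says that [c] is a
    primitive of a continuous function, hence differentiable. The phase changes neither the modulus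
    of [c] nor the product of [n] with the conjugate of [c]. *)
Lemma normc_sq_evolution (c n : R -> R[i]) (w t0 T : R) : t0 < T ->
  continuous (fun t => complex.Re (n t)) -> continuous (fun t => complex.Im (n t)) ->
  (forall t, t0 <= t -> c t = cexpi (- ((t - t0) * w)) * c t0 +
     'i * Cintegral `[t0, t] (fun r => cexpi (- ((t - r) * w)) * n r)) ->
  mu.-integrable `[t0, T] (EFin \o (fun t => - 2 * complex.Im (n t * conjc (c t)))) /\
  \int[mu]_(t in `[t0, T]) (- 2 * complex.Im (n t * conjc (c t))) =
    normc (c T) ^+ 2 - normc (c t0) ^+ 2.
Proof.
move=> t0T cnR cnI duh.
pose m r := cexpi ((r - t0) * w) * n r.
have clin (h : R -> R) : continuous h -> continuous (fun r : R => h ((r - t0) * w)).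
  move=> ch x; apply: continuous_comp; last exact: ch.
  apply: cvgM; last exact: cvg_cst.
  by apply: cvgB; [exact: cvg_id|exact: cvg_cst].
have cmR : continuous (fun r => complex.Re (m r)).
  rewrite /m; under eq_fun do rewrite cReM /=.
  by move=> x; apply: cvgB; apply: cvgM;
    [apply: clin; exact: continuous_cos|exact: cnR|apply: clin; exact: continuous_sin|exact: cnI].
have cmI : continuous (fun r => complex.Im (m r)).
  rewrite /m; under eq_fun do rewrite cImM /=.
  by move=> x; apply: cvgD; apply: cvgM;
    [apply: clin; exact: continuous_cos|exact: cnI|apply: clin; exact: continuous_sin|exact: cnR].
(* The primitives start before [t0] so that they are differentiable on both sides at the endpoint
   [t0] too. *)
pose b := t0 - 1; have bt0 : b < t0 by rewrite /b gtrBl.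
pose A (x : R) := \int[mu]_(y in `[b, x]) complex.Re (m y).
pose B (x : R) := \int[mu]_(y in `[b, x]) complex.Im (m y).
have AE f t : continuous f -> t0 <= t -> \int[mu]_(y in `[t0, t]) f y =
    \int[mu]_(y in `[b, t]) f y - \int[mu]_(y in `[b, t0]) f y :> R.
  move=> cf t0t; rewrite (@Rintegral_itvB _ f (BLeft b) (BRight t) t0).
  - rewrite Rintegral_itv_obnd_cbnd//; apply: integrableS (continuous_integrable t0 t cf) => //.
    exact: subset_itv_oc_cc.
  - exact: continuous_integrable.
  - by rewrite bnd_simp ltW.
  - by rewrite bnd_simp.
pose d t := c t0 + 'i * ((A t - A t0) +i* (B t - B t0)).
have cE t : t0 <= t -> c t = cexpi (- ((t - t0) * w)) * d t.
  move=> t0t; rewrite duh// /d mulrDr; congr (_ + _).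
  have -> : (fun r => cexpi (- ((t - r) * w)) * n r) = (fun r => cexpi (- ((t - t0) * w)) * m r).
    apply/funext => r; rewrite /m mulrA -cexpiD; congr (cexpi _ * _); ring.
  rewrite CintegralZ; last by split; exact: continuous_integrable.
  rewrite mulrCA; congr (_ * (_ * _)).
  by apply/eqP; rewrite eq_complex /= !AE ?eqxx.
have prodE t : t0 <= t -> complex.Im (n t * conjc (c t)) = complex.Im (m t * conjc (d t)).
  move=> t0t; rewrite cE// conjcM conj_cexpi opprK /m; congr complex.Im.
  by rewrite mulrA (mulrC (n t)).
pose G (x : R) := (complex.Re (c t0) - (B x - B t0)) ^+ 2 + (complex.Im (c t0) + (A x - A t0)) ^+ 2.
have GE t : t0 <= t -> normc (c t) ^+ 2 = G t.
  move=> t0t; rewrite cE// normcM normc_cexpi mul1r sqr_normcE /d /G.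
  by rewrite cReD cImD cReM cImM /=; congr (_ ^+ 2 + _ ^+ 2); ring.
pose g (x : R) := - 2 * (complex.Im (m x) * (complex.Re (c t0) - (B x - B t0)) -
                         complex.Re (m x) * (complex.Im (c t0) + (A x - A t0))).
have gE t : t0 <= t -> - 2 * complex.Im (n t * conjc (c t)) = g t.
  move=> t0t; rewrite prodE// /g cImM Re_conjc Im_conjc /d.
  by rewrite cReD cImD cReM cImM /=; ring.
have dA x : b < x -> is_derive x (1 : R) A (complex.Re (m x)) by exact: primitive_is_derive.
have dB x : b < x -> is_derive x (1 : R) B (complex.Im (m x)) by exact: primitive_is_derive.
have cder (F : R -> R) (x l : R) : is_derive x (1 : R) F l -> {for x, continuous F}.
  by move=> [dF _]; apply/differentiable_continuous/derivable1_diffP.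
have bx x : x \in `[t0, T] -> b < x.
  by rewrite in_itv/= => /andP[t0x _]; exact: lt_le_trans t0x.
have [] := @Rintegral_FTC2 R t0 T g G t0T.
- move=> x /bx x1; have cA := cder _ _ _ (dA x x1); have cB := cder _ _ _ (dB x x1).
  rewrite /g; apply: cvgM; first exact: cvg_cst.
  apply: cvgB; apply: cvgM; [exact: cmI| |exact: cmR|].
    apply: cvgB; first exact: cvg_cst.
    by apply: cvgB; [exact: cB|exact: cvg_cst].
  apply: cvgD; first exact: cvg_cst.
  by apply: cvgB; [exact: cA|exact: cvg_cst].
- move=> x /bx x1; have dAx := dA x x1; have dBx := dB x x1.
  rewrite /G; apply: is_derive_eq; rewrite /g /GRing.scale /=; ring.
move=> ig eg; split.
  apply: eq_integrable ig => //= x; rewrite inE /= in_itv/= => /andP[t0x _].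
  by rewrite /= gE.
rewrite !GE//; last exact: ltW.
rewrite -eg; apply: eq_Rintegral => x; rewrite inE /= in_itv/= => /andP[t0x _].
by rewrite gE.
Qed.

End ModeEvolution.

Section Momentum.
Context {R : realType} (alpha : R).
Hypothesis alpha_gt0 : 0 < alpha.
Notation mu := (@lebesgue_measure R).
Notation freq := (freq alpha).
Notation coef := (fourier_coef alpha).
Notation fs := (fourier_series alpha).

Definition momentum (c : int -> R[i]) M : R :=
  \sum_(k <- box M) freq k * normc (c k) ^+ 2.

Variables (c : R -> int -> R[i]) (X Y t0 T : R).
Hypotheses (t0T : t0 < T)
  (cX : forall t L, abs_sum (c t) L <= X)
  (cY : forall t L, \sum_(k <- box L) `|freq k| * normc (c t k) ^+ 2 <= Y)
  (c_cont : forall t e, 0 < e ->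
    \forall t' \near t, forall L, abs_sum (fun k => c t' k - c t k) L <= e)
  (duh : forall t k, t0 <= t -> c t k = free_symbol alpha (t - t0) k * c t0 k +
    'i * Cintegral `[t0, t] (fun r => free_symbol alpha (t - r) k * coef (cubic (fs (c r))) k)).

Let n k t := coef (cubic (fs (c t))) k.

Let n_cont k : continuous (fun t => complex.Re (n k t)) /\
  continuous (fun t => complex.Im (n k t)).
Proof.
have key t e : 0 < e -> \forall t' \near t, normc (n k t' - n k t) < e.
  move=> e0; have K0 : 0 <= 24 * X ^+ 2 by rewrite mulr_ge0// sqr_ge0.
  have e1 : 0 < e / (24 * X ^+ 2 + 1) by rewrite divr_gt0// ltr_wpDl.
  move: (c_cont t e1); apply: filterS => t' h.
  apply: le_lt_trans (fourier_coef_cubic_series_lipschitz alpha_gt0 k (cX t') (cX t) h) _.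
  rewrite mulrA ltr_pdivrMr ?ltr_wpDl//.
  by rewrite mulrDr mulr1 mulrC ltrDl.
split=> t; apply/cvgrPdist_lt => e /(key t); apply: filterS => t' h.
- by rewrite distrC -cReB; apply: le_lt_trans (normRe_le _) h.
- by rewrite distrC -cImB; apply: le_lt_trans (normIm_le _) h.
Qed.

(** The increment of the truncated momentum is the integral of [-2 * flux], to which dominated
    convergence applies with a constant majorant. *)
Lemma momentum_conserved :
  momentum (c T) M - momentum (c t0) M @[M --> \oo] --> (0 : R).
Proof.
have evol k := normc_sq_evolution t0T (n_cont k).1 (n_cont k).2 (fun t h => duh k h).
pose F M t := -2 * flux alpha (c t) M.
have FE M t : F M t = \sum_(k <- box M) freq k * (- 2 * complex.Im (n k t * conjc (c t k))).
  by rewrite /F /flux mulr_sumr; apply: eq_bigr => k _; rewrite mulrCA.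
have iF k : mu.-integrable `[t0, T] (EFin \o (fun t =>
    freq k * (- 2 * complex.Im (n k t * conjc (c t k))))).
  by apply: integrable_segZ; have [] := evol k.
have -> : (fun M => momentum (c T) M - momentum (c t0) M) =
    (fun M => \int[mu]_(t in `[t0, T]) F M t).
  apply/funext => M; under eq_Rintegral do rewrite FE.
  rewrite Rintegral_seg_sum; last exact: iF.
  transitivity (\sum_(k <- box M) (freq k * normc (c T k) ^+ 2 - freq k * normc (c t0 k) ^+ 2)).
    by rewrite sumrB.
  apply: eq_bigr => k _.
  by have [ik ek] := evol k; rewrite RintegralZl// ek mulrBr.
rewrite (_ : 0 = \int[mu]_(t in `[t0, T]) (fun=> 0) t); last by rewrite Rintegral_cst// mul0r.
apply: (@dominated_Rintegral R t0 T _ _ (fun=> 2 * (3 * (X ^+ 2 * Y)))).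
- move=> M; apply/measurable_EFinP.
  have := @integrable_seg_sum R t0 T _ (box M) _ iF.
  move=> /integrableP[+ _]; apply: eq_measurable_fun => t _ /=.
  by rewrite FE.
- by apply: (@bounded_integrable _ _ _ _ `|2 * (3 * (X ^+ 2 * Y))|).
- move=> M t _; rewrite /F normrM normrN (ger0_norm (ler0n R 2)) ler_wpM2l//.
  exact: (flux_bounded alpha_gt0 (cX t) (cY t)).
- apply: aeW => t _; rewrite /F -[X in _ --> X](mulr0 (-2)); apply: cvgM; first exact: cvg_cst.
  exact: (flux_cvg0 alpha_gt0 (cX t) (cY t)).
- by [].
Qed.

End Momentum.

(** * Sobolev norms *)

Section BoxSums.
Context {R : realType}.
Implicit Types (F : int -> R) (B : R).

Lemma box_sum_le_esum F L :
  ((\sum_(k <- box L) F k)%:E <= \esum_(k in [set: int]) (F k)%:E)%E.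
Proof.
apply: esum_ge; exists [set` box L]; first by split=> //; exact: finite_seq.
by rewrite -fsbig_seq ?box_uniq// sumEFin.
Qed.

(** Every finite set of frequencies lies in a box, so bounds on box sums control the unordered
    sum. *)
Lemma esum_le_box_sum F B : (forall k, 0 <= F k) ->
  (forall L, \sum_(k <- box L) F k <= B) ->
  (\esum_(k in [set: int]) (F k)%:E <= B%:E)%E.
Proof.
move=> F0 FB; apply: ge_ereal_sup => _ [A [finA _] <-].
rewrite fsbig_finite//= sumEFin lee_fin.
set r := finmap.enum_fset _.
pose L := \max_(k <- r) `|k|%N.
have rL k : k \in r -> k \in box L.
  by move=> kr; rewrite mem_box; exact: (@leq_bigmax_seq _ r xpredT absz k kr isT).
apply: le_trans (FB L).
have -> : \sum_(k <- r) F k = \sum_(k <- box L | k \in r) F k.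
  rewrite -[RHS]big_filter; apply: perm_big; apply: uniq_perm.
  - exact: finmap.fset_uniq.
  - by rewrite filter_uniq// box_uniq.
  - by move=> k; rewrite mem_filter; case: (boolP (k \in r)) => // /rL ->.
by rewrite [leRHS](bigID (mem r))/= lerDl sumr_ge0.
Qed.

Lemma box_sum_ge0 F L : (forall k, 0 <= F k) -> 0 <= \sum_(k <- box L) F k.
Proof. by move=> F0; apply: sumr_ge0. Qed.

End BoxSums.

Section Weights.
Context {R : realType} (alpha s : R).
Hypotheses (alpha_gt0 : 0 < alpha) (s_gt : 2^-1 < s).
Notation freq := (freq alpha).

Definition sobolev_weight (k : int) : R := (1 + freq k ^+ 2) `^ s.

Lemma weight_gt0 k : 0 < sobolev_weight k.
Proof. by apply: powR_gt0; rewrite ltr_pwDl// sqr_ge0. Qed.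

Lemma weight_ge0 k : 0 <= sobolev_weight k.
Proof. exact/ltW/weight_gt0. Qed.

(** [|x|] is at most [(1 + x^2)^(1/2)], and the base is at least 1, so the exponent may grow to [s].
    This bounds the momentum by the H^s energy. *)
Lemma norm_freq_le_weight k : `|freq k| <= sobolev_weight k.
Proof.
have b1 : 1 <= 1 + freq k ^+ 2 by rewrite lerDl sqr_ge0.
apply: le_trans (ler_powR b1 (ltW s_gt)).
rewrite powR12_sqrt; last by rewrite (le_trans _ b1).
by rewrite -sqrtr_sqr ler_wsqrtr// lerDr.
Qed.

(** A discrete mean value inequality for the power [- q]: from [ln x <= ln y - 1 / y] one gets that
    [x ^ (- q)] is at least [y ^ (- q) * exp (q / y)], and the exponential is at least
    [1 + q / y]. *)
Let telescoping (q : R) (n : nat) : 0 < q ->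
  q * (n.+2%:R `^ (- (q + 1))) <= n.+1%:R `^ (- q) - n.+2%:R `^ (- q).
Proof.
move=> q0; set x : R := n.+1%:R; set y : R := n.+2%:R.
have x0 : 0 < x by rewrite ltr0n.
have y0 : 0 < y by rewrite ltr0n.
have xy : x = y - 1 by rewrite /x /y -[n.+2%:R]natr1; ring.
have -> : y `^ (- (q + 1)) = y `^ (- q) * y^-1.
  rewrite opprD powRD; last by rewrite (gt_eqF y0) implybT.
  by rewrite powR_inv1// ltW.
have lnxy : ln x <= ln y - y^-1.
  have -> : x = y * (1 + (- y^-1)) by rewrite mulrDr mulr1 mulrN divff ?gt_eqF.
  have y1 : y^-1 < 1 by rewrite invf_lt1// /y ltr1n.
  rewrite lnM ?posrE//; last by rewrite subr_gt0.
  by rewrite lerD2l le_ln1Dx// ltrN2.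
have yq0 : 0 < y `^ (- q) by exact: powR_gt0.
suff : y `^ (- q) * (1 + q / y) <= x `^ (- q).
  by rewrite mulrDr mulr1 [q * (_ * _)]mulrCA lerBrDl.
rewrite /powR !gt_eqF//.
have h : expR (- q * ln y) * expR (q / y) <= expR (- q * ln x).
  rewrite -expRD ler_expR !mulNr -lerN2 opprD !opprK -mulrBr; exact: ler_wpM2l (ltW q0) _ _ lnxy.
apply: le_trans h; rewrite ler_wpM2l ?expR_ge0//.
exact: expR_ge1Dx.
Qed.

(** The inverse weight at [n] or [- n] is at most a constant times [n ^ (- 2 s)]. With
    [2 s = q + 1], positivity of [q] is exactly the condition s > 1/2. *)
Lemma inverse_weights_summable : exists W : R, 0 < W /\
  forall L, \sum_(k <- box L) (sobolev_weight k)^-1 <= W.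
Proof.
pose q := 2 * s - 1; have q0 : 0 < q.
  by rewrite /q subr_gt0 -ltr_pdivrMl// mulr1.
have s0 : 0 < s by apply: lt_trans s_gt; rewrite invr_gt0.
pose K := (alpha ^+ 2) `^ (- s).
have K0 : 0 < K by apply: powR_gt0; rewrite exprn_gt0.
have wle (k : int) (n : nat) : k = n.+1%:Z \/ k = - n.+1%:Z ->
    (sobolev_weight k)^-1 <= K * n.+1%:R `^ (- (q + 1)).
  move=> kn; have fk : freq k ^+ 2 = alpha ^+ 2 * n.+1%:R ^+ 2.
    by rewrite /Defs.freq exprMn; case: kn => ->; rewrite ?mulrNz ?sqrrN -pmulrn.
  rewrite /sobolev_weight -powRN fk.
  have -> : n.+1%:R `^ (- (q + 1)) = (n.+1%:R ^+ 2) `^ (- s) :> R.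
    by rewrite -powR_mulrn// -powRrM; congr (_ `^ _); rewrite /q; ring.
  have an0 : 0 < alpha ^+ 2 * n.+1%:R ^+ 2 :> R by rewrite mulr_gt0 ?exprn_gt0.
  rewrite /K -powRM ?sqr_ge0// !powRN lef_pV2 ?posrE ?powR_gt0//; last first.
    by rewrite ltr_pwDl// ltW.
  by apply: ge0_ler_powR; rewrite ?nnegrE ?lerDr ?addr_ge0//; exact: ltW.
have w0 : (sobolev_weight 0)^-1 = 1.
  by rewrite /sobolev_weight /Defs.freq mulr0 expr0n addr0 powR1 invr1.
(* The subtracted remainder closes the induction: by [telescoping], its decrease pays for the two
   new frequencies. *)
have bound n : \sum_(k <- box n.+1) (sobolev_weight k)^-1 <=
    1 + 2 * K * (1 + q^-1) - 2 * K / q * n.+1%:R `^ (- q).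
  elim: n => [|n ih].
    rewrite big_boxS big_box0 w0.
    have := wle 1 0%N (or_introl erefl); have := wle (-1) 0%N (or_intror erefl).
    by rewrite !powR1; lra.
  rewrite big_boxS.
  have h1 := wle n.+2%:Z n.+1 (or_introl erefl).
  have h2 := wle (- n.+2%:Z) n.+1 (or_intror erefl).
  have h3 := telescoping n q0.
  have h4 : 2 * K * n.+2%:R `^ (- (q + 1)) <=
      2 * K / q * (n.+1%:R `^ (- q) - n.+2%:R `^ (- q)).
    rewrite -[2 * K / q * _]mulrA ler_wpM2l ?mulr_ge0 ?(ltW K0)//.
    by rewrite mulrC ler_pdivlMr// mulrC.
  by move: h1 h2 h4 ih; rewrite mulrBr; lra.
exists (1 + 2 * K * (1 + q^-1)); split.
  by rewrite ltr_pwDl// !mulr_ge0 ?(ltW K0)// addr_ge0// invr_ge0 ltW.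
case=> [|n].
  by rewrite big_box0 w0 lerDl !mulr_ge0 ?(ltW K0)// addr_ge0// invr_ge0 ltW.
apply: le_trans (bound n) _; rewrite gerBl !mulr_ge0 ?(ltW K0)//.
  by rewrite invr_ge0 ltW.
Qed.

(* Weighted Cauchy-Schwarz, in the form [2 x <= w x^2 / delta + delta / w]. *)
Lemma abs_sum_le_weighted (c : int -> R[i]) (W delta : R) : 0 < delta ->
  (forall L, \sum_(k <- box L) (sobolev_weight k)^-1 <= W) ->
  (forall L, \sum_(k <- box L) sobolev_weight k * normc (c k) ^+ 2 <= delta ^+ 2) ->
  forall L, \sum_(k <- box L) normc (c k) <= delta * (1 + W).
Proof.
move=> d0 hW hd L.
have -> : delta * (1 + W) = delta^-1 * delta ^+ 2 + delta * W.
  by rewrite mulrDr mulr1; congr (_ + _); field; rewrite gt_eqF.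
apply: (@le_trans _ _ (\sum_(k <- box L)
   (delta^-1 * (sobolev_weight k * normc (c k) ^+ 2) + delta * (sobolev_weight k)^-1))).
  apply: ler_sum => k _; have wk := weight_gt0 k.
  set x := normc (c k); set w := sobolev_weight k.
  have : 0 <= (w * delta)^-1 * (w * x - delta) ^+ 2.
    by rewrite mulr_ge0 ?sqr_ge0// invr_ge0 mulr_ge0 ?ltW.
  have -> : (w * delta)^-1 * (w * x - delta) ^+ 2 =
     delta^-1 * (w * x ^+ 2) + delta * w^-1 - 2 * x by field; rewrite !gt_eqF.
  have := normc_ge0 (c k); rewrite -/x; lra.
rewrite big_split /= -!mulr_sumr; apply: lerD; rewrite ler_wpM2l ?invr_ge0//;
  exact: ltW.
Qed.

End Weights.

Section SobolevNorm.
Context {R : realType} (alpha s : R).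
Notation coef := (fourier_coef alpha).
Notation weight := (sobolev_weight alpha s).
Implicit Types (f : R -> R[i]) (B e : R).

Definition box_energy f L : R := \sum_(k <- box L) weight k * normc (coef f k) ^+ 2.

Let term_ge0 f k : 0 <= weight k * normc (coef f k) ^+ 2.
Proof. by rewrite mulr_ge0 ?weight_ge0// sqr_ge0. Qed.

Lemma Hs_norm_lt_energy f e : 0 < e -> (Hs_norm alpha s f < e%:E)%E ->
  forall L, box_energy f L <= e ^+ 2.
Proof.
move=> e0 he L; rewrite -lee_fin.
apply: (le_trans (box_sum_le_esum (fun k => weight k * normc (coef f k) ^+ 2) L)).
move: he; rewrite /Hs_norm -/(weight _).
set E := (\esum_(k in _) _)%E.
have E0 : (0 <= E)%E by apply: esum_ge0 => k _; rewrite lee_fin; exact: term_ge0.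
case: E E0 => [r| |] // r0; last by rewrite poweRyr// gt_eqF.
rewrite poweR_EFin lte_fin powR12_sqrt// => re.
rewrite lee_fin -(sqr_sqrtr r0) ler_pXn2r ?nnegrE ?sqrtr_ge0//; exact: ltW.
Qed.

Lemma energy_Hs_norm_le f B : (forall L, box_energy f L <= B) ->
  (Hs_norm alpha s f <= (Num.sqrt B)%:E)%E.
Proof.
move=> fB.
have B0 : 0 <= B by apply: le_trans (fB 0%N); apply: box_sum_ge0.
rewrite -powR12_sqrt// -poweR_EFin; apply: gt0_ler_poweR.
- by [].
- by rewrite in_itv/= leey andbT; apply: esum_ge0 => k _; rewrite lee_fin; exact: term_ge0.
- by rewrite in_itv/= leey andbT lee_fin.
- exact: (esum_le_box_sum (term_ge0 f) fB).
Qed.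

End SobolevNorm.

(** * The Akhmediev breather *)

Section PoissonKernel.
Context {R : realType}.
Implicit Types (r theta : R).

Definition poisson_sum r theta L : R :=
  \sum_(k <- box L) r ^+ `|k|%N * cos (theta * k%:~R).

Lemma poisson_sumS r theta L : poisson_sum r theta L.+1 =
  2 * r ^+ L.+1 * cos (theta * L.+1%:R) + poisson_sum r theta L.
Proof.
rewrite /poisson_sum big_boxS abszN absz_nat mulrNz mulrN cosN -pmulrn.
by congr (_ + _); ring.
Qed.

(** Multiplication by the denominator of the Poisson kernel leaves only boundary terms, by the
    three-term recurrence of [cos (theta * n)]. *)
Lemma poisson_sumE r theta L :
  (1 - 2 * r * cos theta + r ^+ 2) * poisson_sum r theta L =
  1 - r ^+ 2 - 2 * r ^+ L.+1 * cos (theta * L.+1%:R) +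
  2 * r ^+ L.+2 * cos (theta * L%:R).
Proof.
elim: L => [|L ih].
  rewrite /poisson_sum big_box0 !mulr0 mulr1 cos0; ring.
rewrite poisson_sumS mulrDr ih.
have -> : cos (theta * L.+2%:R) =
    2 * cos theta * cos (theta * L.+1%:R) - cos (theta * L%:R).
  have -> : theta * L.+2%:R = theta * L.+1%:R + theta.
    by rewrite -[L.+2%:R]natr1; ring.
  have -> : theta * L%:R = theta * L.+1%:R - theta.
    by rewrite -[L.+1%:R]natr1; ring.
  by rewrite cosD cosB; ring.
rewrite !exprS; ring.
Qed.

Lemma poisson_sum_approx r theta L : 0 < r -> r < 1 ->
  `|(1 - r ^+ 2) / (1 - 2 * r * cos theta + r ^+ 2) - poisson_sum r theta L| <=
  4 / (1 - r) ^+ 2 * r ^+ L.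
Proof.
move=> r0 r1; set Q := 1 - 2 * r * cos theta + r ^+ 2.
have q0 : 0 < (1 - r) ^+ 2 by rewrite exprn_gt0// subr_gt0.
have qQ : (1 - r) ^+ 2 <= Q.
  have : r * cos theta <= r * 1 by rewrite ler_wpM2l ?cos_le1// ltW.
  by rewrite /Q; lra.
have Q0 : 0 < Q := lt_le_trans q0 qQ.
have -> : (1 - r ^+ 2) / Q - poisson_sum r theta L =
  (2 * r ^+ L.+1 * cos (theta * L.+1%:R) - 2 * r ^+ L.+2 * cos (theta * L%:R)) / Q.
  apply: (mulIf (lt0r_neq0 Q0)); rewrite mulrBl !divfK ?lt0r_neq0//.
  by rewrite (mulrC (poisson_sum _ _ _)) /Q poisson_sumE; ring.
rewrite normrM normfV (gtr0_norm Q0) [leRHS]mulrAC.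
have rL : 0 <= r ^+ L by rewrite exprn_ge0// ltW.
apply: ler_pM => //; [by rewrite invr_ge0 ltW| |by rewrite lef_pV2 ?posrE].
apply: le_trans (ler_normB _ _) _.
have h n (x : R) : `|2 * r ^+ (L + n) * cos x| <= 2 * r ^+ L.
  rewrite !normrM (ger0_norm (ler0n R 2)) -[leRHS]mulr1; apply: ler_pM => //; last exact: cos_max.
  rewrite exprD normrM (ger0_norm rL) ler_wpM2l// ler_piMr//.
  by rewrite ger0_norm ?exprn_ge0 ?exprn_ile1 ?(ltW r0) ?(ltW r1).
have := lerD (h 1%N (theta * L.+1%:R)) (h 2%N (theta * L%:R)).
rewrite addn1 addn2 => /le_trans; apply; lra.
Qed.

End PoissonKernel.

Section Hyperbolic.
Context {R : realType}.
Implicit Types y : R.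

Lemma cosh_ge1 y : 1 <= cosh y.
Proof. by rewrite /cosh; have := expR_ge1Dx y; have := expR_ge1Dx (- y); lra. Qed.

Lemma norm_sinh_le_cosh y : `|sinh y| <= cosh y.
Proof.
rewrite /sinh /cosh ler_norml.
by have := expR_gt0 y; have := expR_gt0 (- y); move=> ? ?; apply/andP; split; lra.
Qed.

Lemma cosh_ge_half y : y / 2 <= cosh y.
Proof. by rewrite /cosh; have := expR_ge1Dx y; have := expR_gt0 (- y); lra. Qed.

End Hyperbolic.

(** * Fourier coefficients of the breather and their decay *)

Section AkhmedievCoefficients.
Context {R : realType} (a : R).
Hypotheses (a_gt0 : 0 < a) (a_lt : a < 2^-1).
Notation alpha := (akhmediev_alpha a).
Notation beta := (akhmediev_beta a).
Notation trig := (trig_poly alpha).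
Notation coef := (fourier_coef alpha).
Notation C t := (cosh (beta * t)).

Definition akhmediev_amplitude : R := Num.sqrt (2 * a).
Notation c := akhmediev_amplitude.

Lemma akhmediev_alpha_gt0 : 0 < alpha.
Proof. by rewrite sqrtr_gt0 mulr_gt0// subr_gt0 -ltr_pdivlMl// mulr1. Qed.

Lemma akhmediev_beta_gt0 : 0 < beta.
Proof. by rewrite sqrtr_gt0 !mulr_gt0// subr_gt0 -ltr_pdivlMl// mulr1. Qed.

Lemma amplitude_gt0 : 0 < c.
Proof. by rewrite sqrtr_gt0 mulr_gt0. Qed.

Lemma amplitude_lt1 : c < 1.
Proof. by rewrite -sqrtr1 ltr_sqrt// -ltr_pdivlMl// mulr1. Qed.

(* The root of [r ^+ 2 - 2 (C / c) r + 1] in the unit interval, which turns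
   [C - c cos theta] into a multiple of the Poisson kernel denominator. *)
Definition poisson_ratio t : R := (C t - Num.sqrt (C t ^+ 2 - c ^+ 2)) / c.
Notation r := poisson_ratio.

Let c0 := amplitude_gt0.
Let c1 := amplitude_lt1.
Let C1 t : 1 <= C t := cosh_ge1 _.
Let C0 t : 0 < C t := lt_le_trans ltr01 (C1 t).

Lemma poisson_ratio_spec t : [/\ 0 < r t, r t < 1 & 1 + r t ^+ 2 = 2 * r t * C t / c].
Proof.
have cC : c < C t := lt_le_trans c1 (C1 t).
have d0 : 0 < C t ^+ 2 - c ^+ 2.
  by rewrite subr_gt0 ltr_pXn2r ?nnegrE ?ltW.
set D := Num.sqrt (C t ^+ 2 - c ^+ 2).
have D0 : 0 < D by rewrite sqrtr_gt0.
have DE : D ^+ 2 = C t ^+ 2 - c ^+ 2 by rewrite sqr_sqrtr// ltW.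
split.
- rewrite /r -/D divr_gt0// subr_gt0 -(ltr_pXn2r (n := 2)) ?nnegrE ?ltW// DE.
  by rewrite gtrBl exprn_gt0.
- rewrite /r -/D ltr_pdivrMr// mul1r ltrBlDr -ltrBlDl.
  rewrite -(ltr_pXn2r (n := 2)) ?nnegrE ?ltW ?subr_gt0// DE.
  have := mulr_gt0 c0 (_ : 0 < C t - c); rewrite subr_gt0 => /(_ cC).
  by lra.
- rewrite /r -/D.
  apply: (@mulIf _ (c ^+ 2)); first by rewrite expf_neq0// gt_eqF.
  have -> : (1 + ((C t - D) / c) ^+ 2) * c ^+ 2 = c ^+ 2 + (C t - D) ^+ 2.
    by field; rewrite gt_eqF.
  have -> : 2 * ((C t - D) / c) * C t / c * c ^+ 2 = 2 * (C t - D) * C t.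
    by field; rewrite gt_eqF.
  by rewrite sqrrB DE; ring.
Qed.

(** Since [1 + r ^ 2 = 2 * r * C / c] and [r ^ 2 <= 1]. This decay in time drives the nonzero modes
    of the breather to 0. *)
Lemma poisson_ratio_le t : r t <= c / C t.
Proof.
have [r0 r1 rE] := poisson_ratio_spec t.
have : r t ^+ 2 <= 1 by rewrite exprn_ile1 ?ltW.
have -> : r t ^+ 2 = 2 * r t * C t / c - 1 by rewrite -rE; ring.
rewrite ler_pdivlMr// lerBlDr ler_pdivrMr//; lra.
Qed.

Definition akhmediev_kappa t : R[i] :=
  (alpha ^+ 2 * C t) +i* (beta * sinh (beta * t)).
Notation kappa := akhmediev_kappa.

(** The normalization for which [1 / (C t - c cos theta)] is [h t] times the Poisson kernel
    [(1 - r^2) / (1 - 2 r cos theta + r^2)], whose coefficients are [r ^ |k|]. *)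
Definition poisson_scale t : R := (1 + r t ^+ 2) / (C t * (1 - r t ^+ 2)).
Notation h := poisson_scale.

Definition akhmediev_coef t (k : int) : R[i] :=
  cexpi t * ((k == 0)%:R - kappa t * (h t * r t ^+ `|k|%N)%:C).

Let r2lt1 t : r t ^+ 2 < 1.
Proof. by have [r0 r1 _] := poisson_ratio_spec t; rewrite exprn_ilt1 ?ltW. Qed.

Let h_gt0 t : 0 < h t.
Proof.
have [r0 r1 _] := poisson_ratio_spec t.
by rewrite divr_gt0 ?addr_gt0 ?exprn_gt0// mulr_gt0// subr_gt0.
Qed.

Let trig_akhmediev_coef t L x : trig (akhmediev_coef t) L x =
  cexpi t * (1 - kappa t * (h t * poisson_sum (r t) (alpha * x) L)%:C).
Proof.
have mE k : freq alpha k * x = (alpha * x) * k%:~R by rewrite /freq; ring.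
rewrite /trig_poly.
under eq_bigr => k _ do rewrite /akhmediev_coef -mulrA mulrBl.
rewrite -mulr_sumr sumrB; congr (_ * (_ - _)).
  transitivity (\sum_(k <- box L | k == 0) (1 : R[i])); last by rewrite (big_box_pred1 (fun=> 1)).
  rewrite [RHS]big_mkcond; apply: eq_bigr => k _.
  have [->|_] := eqVneq k 0; last by rewrite mul0r.
  by rewrite /mode /freq mulr0 mul0r cexpi0 mulr1.
under eq_bigr => k _ do rewrite -mulrA.
rewrite -mulr_sumr; congr (_ * _).
apply/eqP; rewrite eq_complex cRe_sum cIm_sum /=; apply/andP; split; apply/eqP.
  rewrite /poisson_sum mulr_sumr; apply: eq_bigr => k _.
  by rewrite mul0r subr0 mE mulrA.
(* In the imaginary part the sines of [k] and [- k] cancel, their factors being even in [k]. *)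
elim: L => [|L ih]; first by rewrite big_box0 /freq mulr0 mul0r sin0; ring.
rewrite big_boxS ih !mE abszN mulrNz mulrN sinN; ring.
Qed.

Lemma akhmediev_approx t : exists2 delta : nat -> R,
  forall L x, normc (akhmediev a t x - trig (akhmediev_coef t) L x) <= delta L &
  delta L @[L --> \oo] --> (0 : R).
Proof.
have [r0 r1 rE] := poisson_ratio_spec t.
exists (fun L => normc (kappa t) * h t * (4 / (1 - r t) ^+ 2) * r t ^+ L); last first.
  apply: cvg_geometric; by rewrite ger0_norm// ltW.
move=> L x; rewrite trig_akhmediev_coef.
set Q := 1 - 2 * r t * cos (alpha * x) + r t ^+ 2.
have Q0 : 0 < Q.
  have : r t * cos (alpha * x) <= r t * 1 by rewrite ler_wpM2l ?cos_le1// ltW.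
  have : 0 < (1 - r t) ^+ 2 by rewrite exprn_gt0// subr_gt0.
  by rewrite /Q; lra.
have den : (Num.sqrt (2 * a) * cos (alpha * x) - C t)^-1 =
    - (h t * ((1 - r t ^+ 2) / Q)).
  have CE : C t = c * (1 + r t ^+ 2) / (2 * r t) by rewrite rE; field; rewrite !gt_eqF.
  rewrite -/c /h CE /Q -[LHS]opprK -invrN opprB.
  have p1 : 0 < 1 + r t ^+ 2 by rewrite addr_gt0// exprn_gt0.
  have p2 : 0 < 1 - r t ^+ 2 by rewrite subr_gt0.
  congr (- _).
  have -> : c * (1 + r t ^+ 2) / (2 * r t) - c * cos (alpha * x) = c / (2 * r t) * Q.
    by rewrite /Q; field; rewrite gt_eqF.
  by rewrite -/Q; field; rewrite !gt_eqF.
rewrite /akhmediev -/(kappa t).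
rewrite -mulrBr normcM normc_cexpi mul1r.
have -> : 1 + kappa t / (Num.sqrt (2 * a) * cos (alpha * x) - C t)%:C -
    (1 - kappa t * (h t * poisson_sum (r t) (alpha * x) L)%:C) =
    - (kappa t * (h t * ((1 - r t ^+ 2) / Q - poisson_sum (r t) (alpha * x) L))%:C).
  rewrite -fmorphV den mulrBr rmorphB rmorphN /=; ring.
rewrite normcN normcM normcC normrM (gtr0_norm (h_gt0 t)).
have p := ler_wpM2l (ltW (h_gt0 t)) (poisson_sum_approx (alpha * x) L r0 r1).
by apply: le_trans (ler_wpM2l (normc_ge0 _) p) _; rewrite !mulrA.
Qed.

(** The product of [|kappa| <= (alpha^2 + beta) * C] and [h <= 2 / (C * (1 - c))]; the factors [C]
    cancel, so the bound is uniform in time. *)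
Definition akhmediev_bound : R := 2 * (alpha ^+ 2 + beta) / (1 - c).
Notation K := akhmediev_bound.

Lemma akhmediev_bound_ge0 : 0 <= K.
Proof.
by rewrite divr_ge0 ?subr_ge0 ?(ltW c1)// mulr_ge0// addr_ge0 ?sqr_ge0// ltW// akhmediev_beta_gt0.
Qed.

Let kappa_h_le t : normc (kappa t) * h t <= K.
Proof.
have [r0 r1 rE] := poisson_ratio_spec t.
have kle : normc (kappa t) <= (alpha ^+ 2 + beta) * C t.
  apply: le_trans (normc_le _) _; rewrite /= normrM [X in _ + X]normrM mulrDl lerD//.
    by rewrite (ger0_norm (sqr_ge0 alpha)) (gtr0_norm (C0 t)).
  by rewrite (gtr0_norm akhmediev_beta_gt0) ler_wpM2l ?norm_sinh_le_cosh// ltW// akhmediev_beta_gt0.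
have rc : r t <= c.
  apply: le_trans (poisson_ratio_le t) _.
  by rewrite ler_pdivrMr// ler_peMr// ltW.
have r2c : r t ^+ 2 <= c.
  by rewrite expr2 -[leRHS]mulr1 ler_pM ?(ltW r0) ?(ltW r1).
have hle : h t <= 2 / (C t * (1 - c)).
  rewrite /h; apply: ler_pM.
  - by rewrite addr_ge0// sqr_ge0.
  - by rewrite invr_ge0 mulr_ge0 ?subr_ge0 ?ltW.
  - by rewrite lerD2l ltW.
  - rewrite lef_pV2 ?posrE; first by apply: ler_wpM2l; [exact: ltW|exact: lerB].
      by apply: mulr_gt0; rewrite ?subr_gt0.
    by apply: mulr_gt0; rewrite ?subr_gt0.
apply: le_trans (ler_pM (normc_ge0 _) (ltW (h_gt0 t)) kle hle) _.
rewrite /K le_eqVlt; apply/orP; left; apply/eqP; field.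
by rewrite !gt_eqF ?subr_gt0.
Qed.

(** For [k <> 0], [(c / C) ^ |k|] is at most [c ^ |k| / C]: the power of [c] gives summability in
    [k], and the one factor [1 / C] that is kept gives decay in time. *)
Lemma akhmediev_coef_le t k : k != 0 ->
  normc (akhmediev_coef t k) <= K * c ^+ `|k|%N / C t.
Proof.
move=> k0; rewrite /akhmediev_coef normcM normc_cexpi mul1r (negPf k0) sub0r normcN.
have [r0 r1 rE] := poisson_ratio_spec t.
rewrite normcM normcC normrM (gtr0_norm (h_gt0 t)) [leLHS]mulrA.
rewrite ger0_norm ?exprn_ge0 ?(ltW r0)//.
apply: le_trans (ler_wpM2r _ (kappa_h_le t)) _; first by rewrite exprn_ge0// ltW.
rewrite -mulrA ler_wpM2l ?akhmediev_bound_ge0//.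
apply: (@le_trans _ _ ((c / C t) ^+ `|k|%N)).
  apply: lerXn2r; rewrite ?nnegrE; [exact: ltW| |exact: poisson_ratio_le].
  by apply: divr_ge0; exact: ltW.
rewrite expr_div_n ler_wpM2l ?exprn_ge0 ?(ltW c0)//.
rewrite lef_pV2 ?posrE ?exprn_gt0//.
by rewrite ler_eXnr// absz_gt0.
Qed.

Lemma akhmediev_coef0_le t : normc (akhmediev_coef t 0) <= 1 + K.
Proof.
rewrite /akhmediev_coef normcM normc_cexpi mul1r eqxx mulr1n absz0 expr0 mulr1.
apply: le_trans (le_normcB _ _) _; rewrite normc1 lerD2l.
by rewrite normcM normcC (gtr0_norm (h_gt0 t)) kappa_h_le.
Qed.

Lemma akhmediev_coefN t k : akhmediev_coef t (- k) = akhmediev_coef t k.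
Proof. by rewrite /akhmediev_coef oppr_eq0 abszN. Qed.

(** The real part [alpha ^ 2 * C t] of [kappa t] is positive. This makes the momentum gained by the
    perturbation linear in its size. *)
Lemma akhmediev_coef1_neq0 t : 0 < normc (akhmediev_coef t 1).
Proof.
have [r0 r1 rE] := poisson_ratio_spec t.
rewrite /akhmediev_coef normcM normc_cexpi mul1r sub0r normcN normcM normcC.
rewrite mulr_gt0//; last by rewrite gtr0_norm// mulr_gt0// exprn_gt0.
rewrite lt_neqAle normc_ge0 andbT eq_sym; apply/eqP => /eq0_normc /eqP.
rewrite eq_complex /= => /andP[/eqP e _]; move: e; apply/eqP.
by rewrite gt_eqF// mulr_gt0// exprn_gt0// akhmediev_alpha_gt0.
Qed.

End AkhmedievCoefficients.

Section GeometricWeights.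
Context {R : realType} (alpha s : R).
Hypotheses (alpha_gt0 : 0 < alpha) (s_gt0 : 0 < s).

Lemma sum_box_geometric (c : R) L : 0 < c -> c < 1 ->
  \sum_(k <- box L) c ^+ `|k|%N <= 2 / (1 - c).
Proof.
move=> c0 c1; have d0 : 0 < 1 - c by rewrite subr_gt0.
suff : \sum_(k <- box L) c ^+ `|k|%N <= 2 / (1 - c) - 2 * c ^+ L.+1 / (1 - c).
  move/le_trans; apply; rewrite gerBl divr_ge0 ?(ltW d0) ?mulr_ge0 ?exprn_ge0 ?(ltW c0)//.
rewrite -mulrBl ler_pdivlMr//.
elim: L => [|L ih]; first by rewrite big_box0 expr0 expr1; lra.
rewrite big_boxS abszN absz_nat mulrDl.
have -> : 2 - 2 * c ^+ L.+2 = (c ^+ L.+1 + c ^+ L.+1) * (1 - c) + (2 - 2 * c ^+ L.+1).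
  by rewrite (exprS c L.+1); ring.
by rewrite lerD2l.
Qed.

(* Polynomial growth is absorbed by half of the geometric decay. *)
Lemma weight_geometric (c : R) : 0 < c -> c < 1 ->
  exists2 Z : R, 0 <= Z &
  forall L, \sum_(k <- box L) sobolev_weight alpha s k * (c ^+ `|k|%N) ^+ 2 <= Z.
Proof.
move=> c0 c1; pose g := - ln c.
have g0 : 0 < g by rewrite oppr_gt0 ln_lt0// c0.
(* Chosen so that [expR (e * m)] to the power [2 * s] is [expR (g * m)], the inverse of [c ^ m];
   then [b] is chosen so that [1 + alpha * m <= b * expR (e * m)]. *)
pose e := g / (2 * s); have e0 : 0 < e by rewrite divr_gt0// mulr_gt0.
pose b := 1 + alpha / e; have b0 : 0 < b by rewrite addr_gt0// divr_gt0.
pose N := b `^ (2 * s); have N0 : 0 < N by exact: powR_gt0.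
have wc k : sobolev_weight alpha s k * c ^+ `|k|%N <= N.
  set m : R := `|k|%N%:R; have m0 : 0 <= m by exact: ler0n.
  have kE : k%:~R ^+ 2 = m ^+ 2 :> R.
    by rewrite /m natr_absz intr_norm real_normK ?num_real.
  have cE : c ^+ `|k|%N = expR (- (g * m)).
    by rewrite /g mulNr opprK mulrC /m -{1}(lnK (x := c)) ?posrE// -expRM_natl mulr_natl.
  have h1 : 1 + freq alpha k ^+ 2 <= (b * expR (e * m)) ^+ 2.
    have h2 : 1 + alpha * m <= b * expR (e * m).
      have : b * (1 + e * m) <= b * expR (e * m).
        by rewrite ler_wpM2l ?expR_ge1Dx// ltW.
      apply: le_trans; rewrite /b.
      have -> : (1 + alpha / e) * (1 + e * m) = 1 + alpha * m + (alpha / e + e * m).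
        by field; rewrite gt_eqF.
      by rewrite lerDl; apply: addr_ge0; apply: mulr_ge0; rewrite ?invr_ge0 ?(ltW e0) ?(ltW alpha_gt0).
    have am0 : 0 <= alpha * m by rewrite mulr_ge0// ltW.
    have : (1 + alpha * m) ^+ 2 <= (b * expR (e * m)) ^+ 2.
      by apply: lerXn2r => //; rewrite nnegrE ?addr_ge0// mulr_ge0 ?expR_ge0 ?ltW.
    by apply: le_trans; rewrite /freq exprMn kE; lra.
  have h3 : sobolev_weight alpha s k <= N * expR (g * m).
    apply: (@le_trans _ _ (((b * expR (e * m)) ^+ 2) `^ s)).
      apply: ge0_ler_powR => //; rewrite ?nnegrE ?addr_ge0 ?sqr_ge0//; exact: ltW.
    rewrite -powR_mulrn; last by rewrite mulr_ge0 ?expR_ge0 ?ltW.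
    rewrite -powRrM powRM ?expR_ge0 ?(ltW b0)// ler_wpM2l ?(ltW N0)//.
    rewrite /powR gt_eqF ?expR_gt0// expRK ler_expR /e le_eqVlt; apply/orP; left.
    by apply/eqP; field; rewrite gt_eqF.
  rewrite cE; apply: le_trans (ler_wpM2r (expR_ge0 _) h3) _.
  by rewrite -mulrA -expRD subrr expR0 mulr1.
exists (N * (2 / (1 - c))).
  by rewrite mulr_ge0 ?(ltW N0)// divr_ge0// subr_ge0 ltW.
move=> L; apply: le_trans (ler_wpM2l (ltW N0) (sum_box_geometric L c0 c1)).
rewrite mulr_sumr; apply: ler_sum => k _.
by rewrite expr2 mulrA ler_wpM2r// exprn_ge0// ltW.
Qed.

End GeometricWeights.

Section OrbitCoefficients.
Context {R : realType} (a : R).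
Hypotheses (a_gt0 : 0 < a) (a_lt : a < 2^-1).
Notation alpha := (akhmediev_alpha a).
Notation trig := (trig_poly alpha).
Notation coef := (fourier_coef alpha).
Let alpha0 : 0 < alpha := akhmediev_alpha_gt0 a_lt.

Definition orbit_coef (gamma y t : R) (k : int) : R[i] :=
  cexpi gamma * (akhmediev_coef a t k * mode alpha k (- y)).

(** Uniform approximation survives a phase and a translation; translating by [y] multiplies the
    [k]-th coefficient by the unimodular [mode alpha k (- y)], so the whole orbit shares the same
    energies. *)
Lemma akhmediev_orbit (gamma y t : R) :
  bounded_measurable (fun x => cexpi gamma * akhmediev a t (x - y)) /\
  forall k, coef (fun x => cexpi gamma * akhmediev a t (x - y)) k = orbit_coef gamma y t k.
Proof.
have [delta hd d0] := akhmediev_approx a_gt0 a_lt t.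
apply: (uniform_trig_limit alpha0 _ d0) => L x.
have -> : trig (orbit_coef gamma y t) L x = cexpi gamma * trig (akhmediev_coef a t) L (x - y).
  rewrite /trig_poly mulr_sumr; apply: eq_bigr => k _; rewrite /orbit_coef.
  rewrite -!mulrA; congr (_ * (_ * _)).
  by rewrite /mode -cexpiD -mulrDr [- y + x]addrC.
by rewrite -mulrBr normcM normc_cexpi mul1r.
Qed.

Lemma akhmediev_bounded_measurable t : bounded_measurable (akhmediev a t).
Proof.
have [bm _] := akhmediev_orbit 0 0 t.
rewrite (_ : akhmediev a t = fun x => cexpi 0 * akhmediev a t (x - 0))//.
by apply/funext => x; rewrite cexpi0 mul1r subr0.
Qed.

Lemma fourier_coef_akhmediev t k : coef (akhmediev a t) k = akhmediev_coef a t k.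
Proof.
have [_ h] := akhmediev_orbit 0 0 t.
rewrite (_ : akhmediev a t = fun x => cexpi 0 * akhmediev a t (x - 0)).
  by rewrite h /orbit_coef /mode oppr0 mulr0 cexpi0 mul1r mulr1.
by apply/funext => x; rewrite cexpi0 mul1r subr0.
Qed.

Lemma normc_orbit_coef gamma y t k :
  normc (orbit_coef gamma y t k) = normc (akhmediev_coef a t k).
Proof. by rewrite /orbit_coef !normcM normc_cexpi normc_mode mul1r mulr1. Qed.

Lemma akhmediev_period t x : akhmediev a t (x + period alpha) = akhmediev a t x.
Proof.
have e : alpha * (x + period alpha) = alpha * x + pi *+ 2.
  by rewrite mulrDr alpha_period// mulr_natl.
by rewrite /akhmediev e cosD2pi.
Qed.

End OrbitCoefficients.

Lemma sum_box_odd (R : realType) (F : int -> R) L :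
  (forall k, F (- k) = - F k) -> \sum_(k <- box L) F k = 0.
Proof.
move=> FN; have F0 : F 0 = 0 by have := FN 0; rewrite oppr0; lra.
by elim: L => [|L ih]; rewrite ?big_box0// big_boxS ih FN subrr addr0.
Qed.

(** * Energy estimates and momentum of Sobolev solutions *)

Section SobolevSolutions.
Context {R : realType} (alpha s : R).
Hypotheses (alpha_gt0 : 0 < alpha) (s_gt : 2^-1 < s).
Notation P := (period alpha).
Notation coef := (fourier_coef alpha).
Notation weight := (sobolev_weight alpha s).
Implicit Types (f g : R -> R[i]) (c d : int -> R[i]).

Lemma Hs_Cintegrable f : Hs alpha s f -> Cintegrable 0 P f.
Proof. by case=> _ mR mI fi _; exact: square_integrable_Cintegrable. Qed.

Lemma bounded_measurable_Hs f (B : R) : (forall x, f (x + P) = f x) ->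
  bounded_measurable f -> (forall L, box_energy alpha s f L <= B) -> Hs alpha s f.
Proof.
move=> fP bf fB; have [[mR mI] _] := bf; split=> //.
  have [iR _] := bounded_Cintegrable 0 P (bounded_measurableM bf (bounded_measurable_conj bf)).
  move: iR => /integrableP[_]; apply: le_lt_trans.
  rewrite le_eqVlt; apply/orP; left; apply/eqP; apply: eq_integral => x _ /=.
  by rewrite conj_mul_self /= ger0_norm// sqr_ge0.
exact: le_lt_trans (energy_Hs_norm_le fB) (ltry _).
Qed.

Lemma Hs_dist_energy f g (e : R) : Cintegrable 0 P f -> Cintegrable 0 P g -> 0 < e ->
  (Hs_dist alpha s f g < e%:E)%E ->
  forall L, \sum_(k <- box L) weight k * normc (coef f k - coef g k) ^+ 2 <= e ^+ 2.
Proof.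
move=> fi gi e0 /(Hs_norm_lt_energy e0) h L; apply: le_trans (h L).
by apply: ler_sum => k _; rewrite fourier_coefB.
Qed.

(** [(x + y)^2 <= 2 x^2 + 2 y^2] termwise. The predicate survives only on [d], so the same bound
    serves the full energy and that of the nonzero modes. *)
Lemma weighted_sum_split c d (p : pred int) L :
  \sum_(k <- box L | p k) weight k * normc (c k) ^+ 2 <=
  2 * (\sum_(k <- box L) weight k * normc (c k - d k) ^+ 2) +
  2 * (\sum_(k <- box L | p k) weight k * normc (d k) ^+ 2).
Proof.
apply: (@le_trans _ _ (2 * (\sum_(k <- box L | p k) weight k * normc (c k - d k) ^+ 2) +
  2 * (\sum_(k <- box L | p k) weight k * normc (d k) ^+ 2))).
  rewrite !mulr_sumr -big_split /=; apply: ler_sum => k _.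
  rewrite !(mulrCA 2) -mulrDr ler_wpM2l ?weight_ge0//.
  have h : normc (c k) <= normc (c k - d k) + normc (d k).
    by rewrite -{1}(subrK (d k) (c k)) le_normcD.
  have := sqr_ge0 (normc (c k - d k) - normc (d k)).
  have : normc (c k) ^+ 2 <= (normc (c k - d k) + normc (d k)) ^+ 2.
    by rewrite ler_pXn2r ?nnegrE ?addr_ge0 ?normc_ge0.
  by lra.
rewrite lerD2r ler_wpM2l// [leRHS](bigID p)/= lerDl.
by apply: sumr_ge0 => k _; rewrite mulr_ge0 ?weight_ge0 ?sqr_ge0.
Qed.

Lemma momentum_le_weighted c M : `|momentum alpha c M| <=
  \sum_(k <- box M | k != 0) weight k * normc (c k) ^+ 2.
Proof.
apply: le_trans (ler_norm_sum _ _ _) _; rewrite [leRHS]big_mkcond.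
apply: ler_sum => k _; have [->|k0] := eqVneq k 0.
  by rewrite /= /freq mulr0 mul0r normr0.
rewrite normrM (ger0_norm (sqr_ge0 _)) ler_wpM2r ?sqr_ge0//.
exact: norm_freq_le_weight.
Qed.

(** The energy bound [E], uniform in time, will come from orbital stability. With the inverse
    weights it makes the coefficients absolutely summable uniformly in time, and it turns continuity
    in H^s into continuity in l^1. *)
Lemma global_solution_momentum t0 u0 u (E T : R) : 0 < E -> t0 < T ->
  global_solution alpha s t0 u0 u ->
  (forall t L, \sum_(k <- box L) weight k * normc (coef (u t) k) ^+ 2 <= E ^+ 2) ->
  momentum alpha (coef (u T)) M - momentum alpha (coef (u t0)) M @[M --> \oo] --> (0 : R).
Proof.
move=> E0 t0T [ut0 uHs ucont udu] uE.
have [W [W0 hW]] := inverse_weights_summable alpha_gt0 s_gt.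
have cX t L : abs_sum (coef (u t)) L <= E * (1 + W).
  exact: (abs_sum_le_weighted E0 hW (uE t)).
have cub t k : coef (cubic (u t)) k = coef (cubic (fourier_series alpha (coef (u t)))) k.
  by have [_ mR mI fi _] := uHs t; exact: (fourier_coef_cubic_series alpha_gt0 (conj mR mI) fi (cX t)).
apply: (momentum_conserved alpha_gt0 t0T cX (Y := E ^+ 2)).
- move=> t L; apply: le_trans (uE t L); apply: ler_sum => k _.
  by rewrite ler_wpM2r ?sqr_ge0// norm_freq_le_weight.
- move=> t e e0; have W1 : 0 < 1 + W by rewrite addr_gt0.
  have d0 : 0 < e / (1 + W) by rewrite divr_gt0.
  have : \forall t' \near t, (Hs_dist alpha s (u t') (u t) < (e / (1 + W))%:E)%E.
    have := ucont t; move=> /(_ [set x | (x < (e / (1 + W))%:E)%E]); apply.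
    exact: (open_ereal_lt' (x := 0%E)).
  apply: filterS => t' h L.
  have -> : e = e / (1 + W) * (1 + W) by rewrite divfK// gt_eqF.
  apply: (abs_sum_le_weighted d0 hW).
  by apply: Hs_dist_energy => //; exact: Hs_Cintegrable.
- move=> t k t0t; rewrite udu ut0 /Cintegral_from_to t0t.
  by congr (_ + _ * Cintegral _ _); apply/funext => r; rewrite cub.
Qed.

End SobolevSolutions.

(** * Instability *)

Section Instability.
Context {R : realType} (a s : R).
Hypotheses (a_gt0 : 0 < a) (a_lt : a < 2^-1) (s_gt : 2^-1 < s).
Notation alpha := (akhmediev_alpha a).
Notation beta := (akhmediev_beta a).
Notation P := (period alpha).
Notation coef := (fourier_coef alpha).
Notation weight := (sobolev_weight alpha s).
Notation K := (akhmediev_bound a).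
Let alpha0 : 0 < alpha := akhmediev_alpha_gt0 a_lt.

Lemma akhmediev_energy : exists2 Z : R, 0 <= Z &
  forall t L, \sum_(k <- box L | k != 0) weight k * normc (akhmediev_coef a t k) ^+ 2
    <= K ^+ 2 * Z / cosh (beta * t) ^+ 2.
Proof.
have s0 : 0 < s by apply: lt_trans s_gt; rewrite invr_gt0.
have c0 := amplitude_gt0 a_gt0; have c1 := amplitude_lt1 a_lt.
have [Z Z0 hZ] := weight_geometric alpha0 s0 c0 c1.
exists Z => // t L; have C0 : 0 < cosh (beta * t) := lt_le_trans ltr01 (cosh_ge1 _).
set c := akhmediev_amplitude a in c0 c1 hZ *.
apply: (@le_trans _ _ (K ^+ 2 / cosh (beta * t) ^+ 2 *
    \sum_(k <- box L) weight k * (c ^+ `|k|%N) ^+ 2)); last first.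
  rewrite -[leRHS]mulrA [Z / _]mulrC mulrA ler_wpM2l//.
  by rewrite divr_ge0 ?sqr_ge0.
rewrite mulr_sumr [leRHS](bigID (fun k => k != 0))/= -[leLHS]addr0 lerD//; last first.
  apply: sumr_ge0 => k _; apply: mulr_ge0; first by rewrite divr_ge0 ?sqr_ge0.
  by apply: mulr_ge0; [exact: weight_ge0|exact: sqr_ge0].
apply: ler_sum => k k0; rewrite [leRHS]mulrCA ler_wpM2l ?weight_ge0//.
have E (x y z : R) : x ^+ 2 / z ^+ 2 * y ^+ 2 = (x * y / z) ^+ 2.
  by rewrite expr_div_n exprMn mulrAC.
rewrite E.
have h := akhmediev_coef_le a_gt0 a_lt t k0.
by apply: lerXn2r => //; rewrite nnegrE ?normc_ge0// (le_trans (normc_ge0 _) h).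
Qed.

Lemma weight0 : weight 0 = 1.
Proof. by rewrite /sobolev_weight /freq mulr0 expr0n addr0 powR1. Qed.

Lemma akhmediev_energy_bounded : exists2 B : R, 0 <= B &
  forall t L, \sum_(k <- box L) weight k * normc (akhmediev_coef a t k) ^+ 2 <= B.
Proof.
have [Z Z0 hZ] := akhmediev_energy.
have K0 := akhmediev_bound_ge0 a_gt0 a_lt.
exists ((1 + K) ^+ 2 + K ^+ 2 * Z).
  by rewrite addr_ge0 ?sqr_ge0// mulr_ge0 ?sqr_ge0.
move=> t L; rewrite (bigID (fun k => k == 0))/=; apply: lerD.
  rewrite (big_box_pred1 (fun k => weight k * normc (akhmediev_coef a t k) ^+ 2))//.
  rewrite weight0 mul1r; apply: lerXn2r; rewrite ?nnegrE ?normc_ge0 ?addr_ge0//.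
  exact: akhmediev_coef0_le.
apply: le_trans (hZ t L) _.
have C1 : 1 <= cosh (beta * t) := cosh_ge1 _.
rewrite ler_pdivrMr ?exprn_gt0 ?(lt_le_trans ltr01 C1)//.
by apply: ler_peMr; [rewrite mulr_ge0 ?sqr_ge0|exact: exprn_ege1].
Qed.

Section InitialDatum.
Variables (t0 lam : R).
Hypothesis lam_gt0 : 0 < lam.
Notation A1 := (normc (akhmediev_coef a t0 1)).

Definition perturbed_datum (x : R) : R[i] :=
  akhmediev a t0 x + lam%:C * akhmediev_coef a t0 1 * mode alpha 1 x.

Let bump_bounded : bounded_measurable
  (fun x => lam%:C * akhmediev_coef a t0 1 * mode alpha 1 x).
Proof.
by apply: bounded_measurableM; [exact: bounded_measurable_cst|exact: bounded_measurable_mode].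
Qed.

Lemma fourier_coef_bump k :
  coef (fun x => lam%:C * akhmediev_coef a t0 1 * mode alpha 1 x) k =
  lam%:C * akhmediev_coef a t0 1 * (1 == k)%:R.
Proof.
rewrite fourier_coefZ; last exact/bounded_Cintegrable/bounded_measurable_mode.
by rewrite fourier_coef_mode.
Qed.

Lemma fourier_coef_perturbed k : coef perturbed_datum k =
  akhmediev_coef a t0 k + lam%:C * akhmediev_coef a t0 1 * (1 == k)%:R.
Proof.
rewrite fourier_coefD; first by rewrite fourier_coef_akhmediev// fourier_coef_bump.
- exact/bounded_Cintegrable/akhmediev_bounded_measurable.
- exact: bounded_Cintegrable.
Qed.

Lemma bump_energy L :
  \sum_(k <- box L) weight k * normc (lam%:C * akhmediev_coef a t0 1 * (1 == k)%:R) ^+ 2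
  <= weight 1 * (lam * A1) ^+ 2.
Proof.
apply: le_trans (sum_box_pred1_le 1 L _); last by rewrite mulr_ge0 ?weight_ge0 ?sqr_ge0.
rewrite [leRHS]big_mkcond; apply: ler_sum => k _; rewrite eq_sym.
have [->|_] := eqVneq k 1; last by rewrite mulr0 normc0 expr0n mulr0.
by rewrite mulr1 normcM normcC gtr0_norm.
Qed.

Lemma perturbed_datum_Hs : Hs alpha s perturbed_datum.
Proof.
have [B B0 hB] := akhmediev_energy_bounded.
apply: (@bounded_measurable_Hs _ _ _ _ (2 * (weight 1 * (lam * A1) ^+ 2) + 2 * B)).
- by move=> x; rewrite /perturbed_datum (akhmediev_period a_lt) (mode_period alpha0).
- by apply: bounded_measurableD => //; exact: akhmediev_bounded_measurable.
move=> L; apply: le_trans (weighted_sum_split _ _ _ (akhmediev_coef a t0) xpredT L) _.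
apply: lerD; rewrite ler_wpM2l//.
apply: le_trans (bump_energy L); apply: ler_sum => k _.
by rewrite fourier_coef_perturbed addrAC subrr add0r.
Qed.

Lemma perturbed_datum_dist :
  (Hs_dist alpha s perturbed_datum (akhmediev a t0) <= (Num.sqrt (weight 1) * (lam * A1))%:E)%E.
Proof.
have -> : Num.sqrt (weight 1) * (lam * A1) = Num.sqrt (weight 1 * (lam * A1) ^+ 2).
  by rewrite sqrtrM ?weight_ge0// sqrtr_sqr ger0_norm// mulr_ge0 ?normc_ge0 ?ltW.
apply: energy_Hs_norm_le => L; apply: le_trans (bump_energy L).
apply: ler_sum => k _; rewrite -fourier_coef_bump.
rewrite (_ : (fun x => perturbed_datum x - akhmediev a t0 x) =
  fun x => lam%:C * akhmediev_coef a t0 1 * mode alpha 1 x)//.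
by apply/funext => x; rewrite /perturbed_datum addrAC subrr add0r.
Qed.

(** The box has to contain the mode 1, whence [M.+1]. The momentum of the breather cancels between
    [k] and [- k]; the first coefficient is multiplied by [1 + lam], and
    [(1 + lam)^2 - 1 >= 2 lam]. *)
Lemma momentum_perturbed M :
  2 * alpha * lam * A1 ^+ 2 <= momentum alpha (coef perturbed_datum) M.+1.
Proof.
rewrite /momentum.
have -> : \sum_(k <- box M.+1) freq alpha k * normc (coef perturbed_datum k) ^+ 2 =
    \sum_(k <- box M.+1) freq alpha k * normc (akhmediev_coef a t0 k) ^+ 2 +
    \sum_(k <- box M.+1 | k == 1) alpha * ((1 + lam) ^+ 2 - 1) * A1 ^+ 2.
  rewrite [X in _ + X]big_mkcond -big_split; apply: eq_bigr => k _.
  rewrite -[RHS]/(freq alpha k * normc (akhmediev_coef a t0 k) ^+ 2 +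
    (if k == 1 then alpha * ((1 + lam) ^+ 2 - 1) * A1 ^+ 2 else 0)).
  rewrite fourier_coef_perturbed [1 == k]eq_sym.
  have [->|_] := eqVneq k 1; last by rewrite mulr0 !addr0.
  rewrite mulr1 -[X in normc (X + _)]mul1r -mulrDl normcM.
  have -> : normc (1 + lam%:C) = 1 + lam.
    rewrite (_ : 1 + lam%:C = (1 + lam)%:C); last by rewrite rmorphD rmorph1.
    by rewrite normcC ger0_norm// addr_ge0// ltW.
  by rewrite /freq mulr1 exprMn; ring.
rewrite sum_box_odd; last by move=> k; rewrite freqN akhmediev_coefN mulNr.
rewrite add0r (big_box_pred1 (fun=> alpha * ((1 + lam) ^+ 2 - 1) * A1 ^+ 2))//.
rewrite (_ : 2 * alpha * lam = alpha * (2 * lam)); last by ring.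
rewrite ler_wpM2r ?sqr_ge0// ler_wpM2l ?(ltW alpha0)//.
by have := sqr_ge0 lam; lra.
Qed.

End InitialDatum.

Lemma akhmediev_unstable t0 : ~ orbitally_stable alpha s t0 (akhmediev a).
Proof.
move=> [C0 [eps0 [C0_gt0 eps0_gt0 stab]]].
set A1 := normc (akhmediev_coef a t0 1).
have A1_gt0 : 0 < A1 by exact: akhmediev_coef1_neq0.
set w1 := Num.sqrt (weight 1).
have w1_gt0 : 0 < w1 by rewrite sqrtr_gt0 weight_gt0.
(* With [lam] as below, [q * eps] equals the lower bound [2 * alpha * lam * A1 ^ 2] of the initial
   momentum. *)
pose q := alpha * A1 / w1; have q_gt0 : 0 < q by rewrite divr_gt0// mulr_gt0.
(* At time [T], [Q * eps ^ 2] collects [2 * (C0 * eps) ^ 2] from the distance to the orbit and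
   [2 * eps ^ 2] from the nonzero modes of the breather. *)
pose Q := 2 * C0 ^+ 2 + 2; have Q_gt0 : 0 < Q by rewrite addr_gt0// mulr_gt0// exprn_gt0.
pose eps := Num.min (eps0 / 2) (q / (2 * Q)).
have eps_gt0 : 0 < eps by rewrite lt_min !divr_gt0// mulr_gt0.
have eps_lt : eps < eps0 by rewrite gt_min; apply/orP; left; lra.
have epsQ : Q * eps <= q / 2.
  have : eps <= q / (2 * Q) by rewrite ge_min lexx orbT.
  move/(ler_wpM2l (ltW Q_gt0))/le_trans; apply.
  by rewrite le_eqVlt; apply/orP; left; apply/eqP; field; rewrite gt_eqF.
(* Makes the perturbation have H^s size at most [eps / 2], hence strictly below [eps]. *)
pose lam := eps / (2 * w1 * A1).
have lam_gt0 : 0 < lam by rewrite divr_gt0// !mulr_gt0.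
have dist0 : (Hs_dist alpha s (perturbed_datum t0 lam) (akhmediev a t0) < eps%:E)%E.
  apply: le_lt_trans (perturbed_datum_dist t0 lam_gt0) _; rewrite lte_fin -/w1 -/A1.
  have -> : w1 * (lam * A1) = eps / 2 by rewrite /lam; field; rewrite !gt_eqF.
  by lra.
have [u sol [y [gamma hsup]]] := stab eps eps_gt0 eps_lt _ (perturbed_datum_Hs t0 lam_gt0) dist0.
have [ut0 uHs _ _] := sol.
have Ce_gt0 : 0 < C0 * eps by rewrite mulr_gt0.
pose orb t k := orbit_coef a (gamma t) (y t) t k.
have close t L : \sum_(k <- box L) weight k * normc (coef (u t) k - orb t k) ^+ 2 <= (C0 * eps) ^+ 2.
  have [bm orbE] := akhmediev_orbit a_gt0 a_lt (gamma t) (y t) t.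
  under eq_bigr => k _ do rewrite /orb -orbE.
  apply: Hs_dist_energy => //.
  - exact: Hs_Cintegrable (uHs t).
  - exact: bounded_Cintegrable.
  - apply: le_lt_trans hsup; apply: ereal_sup_ubound; by exists t.
have [B B0 hB] := akhmediev_energy_bounded.
pose E2 := 2 * (C0 * eps) ^+ 2 + 2 * B.
have E2_gt0 : 0 < E2 by rewrite ltr_pwDl ?mulr_ge0// mulr_gt0 ?exprn_gt0.
have uE t L : \sum_(k <- box L) weight k * normc (coef (u t) k) ^+ 2 <= Num.sqrt E2 ^+ 2.
  rewrite sqr_sqrtr ?(ltW E2_gt0)//.
  apply: le_trans (weighted_sum_split _ _ _ (orb t) xpredT L) _.
  apply: lerD; rewrite ler_wpM2l//.
  by apply: le_trans (hB t L); apply: ler_sum => k _; rewrite normc_orbit_coef.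
have [Z Z0 hZ] := akhmediev_energy.
have K0 := akhmediev_bound_ge0 a_gt0 a_lt.
have beta0 := akhmediev_beta_gt0 a_gt0 a_lt.
(* From [cosh y >= y / 2], the second entry forces [cosh (beta * T)] above
   [K ^ 2 * Z / eps ^ 2 + 1]; as it is at least 1, its square is above that too. *)
pose T := Num.max (t0 + 1) (2 * (K ^+ 2 * Z / eps ^+ 2 + 1) / beta).
have t0T : t0 < T by rewrite lt_max ltrDl ltr01.
have energyT : K ^+ 2 * Z / cosh (beta * T) ^+ 2 <= eps ^+ 2.
  have X0 : 0 <= K ^+ 2 * Z / eps ^+ 2.
    by apply: divr_ge0; [apply: mulr_ge0 => //; exact: sqr_ge0|exact: sqr_ge0].
  have CX : K ^+ 2 * Z / eps ^+ 2 + 1 <= cosh (beta * T).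
    apply: le_trans (cosh_ge_half _).
    have : 2 * (K ^+ 2 * Z / eps ^+ 2 + 1) / beta <= T by rewrite le_max lexx orbT.
    by rewrite ler_pdivrMr// ler_pdivlMr// (mulrC beta) (mulrC 2).
  have C1 : 1 <= cosh (beta * T) := cosh_ge1 _.
  have C_gt0 := lt_le_trans ltr01 C1.
  rewrite ler_pdivrMr ?exprn_gt0// [leRHS]mulrC -ler_pdivrMr ?exprn_gt0//.
  apply: (@le_trans _ _ (cosh (beta * T))); first by rewrite (le_trans _ CX)// lerDl.
  by rewrite expr2 ler_peMr// ltW.
have momT M : momentum alpha (coef (u T)) M <= Q * eps ^+ 2.
  apply: le_trans (ler_norm _) _; apply: le_trans (momentum_le_weighted alpha s_gt _ M) _.
  apply: le_trans (weighted_sum_split _ _ _ (orb T) (fun k => k != 0) M) _.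
  have h1 := close T M.
  have h2 : \sum_(k <- box M | k != 0) weight k * normc (orb T k) ^+ 2 <= eps ^+ 2.
    apply: le_trans energyT; apply: le_trans (hZ T M).
    by apply: ler_sum => k _; rewrite normc_orbit_coef.
  rewrite exprMn in h1; rewrite /Q; lra.
have mom0 M : q * eps <= momentum alpha (coef (u t0)) M.+1.
  rewrite ut0; apply: le_trans (momentum_perturbed t0 lam_gt0 M).
  rewrite -/A1 le_eqVlt; apply/orP; left; apply/eqP.
  by rewrite /q /lam; field; rewrite !gt_eqF.
have sE2 : 0 < Num.sqrt E2 by rewrite sqrtr_gt0.
have lim0 := global_solution_momentum alpha0 s_gt sE2 t0T sol uE.
(* For nonempty ranges of nonzero modes the momentum difference is at most [Q * eps ^ 2 - q * eps],
   hence at most [- q * eps / 2]; its limit 0 would satisfy the same bound. *)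
have : (0 : R) <= - (q * eps / 2).
  rewrite -(cvg_lim (@Rhausdorff R) lim0); apply: limr_le; first by apply: cvgP lim0.
  near=> M.
  have [n ->] : exists n, M = n.+1.
    by exists M.-1; rewrite prednK//; near: M; exists 1%N.
  have h1 := momT n.+1; have h2 := mom0 n.
  have h3 := ler_wpM2r (ltW eps_gt0) epsQ.
  by rewrite expr2 in h1; lra.
by rewrite oppr_ge0 leNgt divr_gt0// mulr_gt0.
Unshelve. all: by end_near. Qed.

End Instability.

Theorem theorem1p1 (R : realType) (a : R) (a_gt0 : 0 < a) (a_lt : a < 2^-1)
    (s : R) (s_gt : 2^-1 < s) (t0 : R) :
  ~ orbitally_stable (akhmediev_alpha a) s t0 (akhmediev a).
Proof. exact: akhmediev_unstable. Qed.
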